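(* Let $\mathsf{C}$ be a strict braided monoidal category. The category $\mathsf{cocPost}\text{-}\mathsf{Hopf}^{\star}$ (cocommutative post-Hopf algebras $(H,m_H)$ in $\mathsf{C}$ satisfying condition $(\star)$ of the context) and the category $\mathsf{cocBT^{f}}$ of finite cocommutative brace triples in $\mathsf{C}$ are isomorphic.
   Context: $\mathsf{C}$ is a strict braided monoidal category with tensor product $\otimes$, unit object $K$ and braiding $c$ (not assumed symmetric). For an object $P$ and a morphism $f$, $P\otimes f$ means $id_P\otimes f$ and $f\otimes P$ means $f\otimes id_P$. Algebras, coalgebras, bialgebras and Hopf algebras are internal to $\mathsf{C}$; the tensor product of coalgebras $D,E$ has coproduct $(D\otimes c_{D,E}\otimes E)\circ(\delta_D\otimes\delta_E)$ and counit $\varepsilon_D\otimes\varepsilon_E$, and the tensor product of algebras $A,B$ has product $(\mu_A\otimes\mu_B)\circ(A\otimes c_{B,A}\otimes B)$. A Hopf algebra $H=(H,\eta_H,\mu_H,\varepsilon_H,\delta_H,\lambda_H)$ is a bialgebra with a morphism (antipode) $\lambda_H$ such that $\mu_H\circ(H\otimes\lambda_H)\circ\delta_H=\eta_H\circ\varepsilon_H=\mu_H\circ(\lambda_H\otimes H)\circ\delta_H$; it is cocommutative if $c_{H,H}\circ\delta_H=\delta_H$. Hopf algebra morphisms are morphisms that are both algebra and coalgebra morphisms. An object $P$ is finite if there is an object $P^*$ (its dual) and a $\mathsf{C}$-adjunction $P\otimes-\dashv P^*\otimes-$; the unit and counit evaluated at $K$ are morphisms $a_P:K\to P^*\otimes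 P$ and $b_P:P\otimes P^*\to K$ with $(b_P\otimes P)\circ(P\otimes a_P)=id_P$ and $(P^*\otimes b_P)\circ(a_P\otimes P^* )=id_{P^*}$. Post-Hopf algebra: a pair $(H,m_H)$ with $H$ a finite Hopf algebra in $\mathsf{C}$ and $m_H:H\otimes H\to H$ a morphism such that (i) $m_H$ is a coalgebra morphism; (ii) $m_H\circ(H\otimes m_H)=m_H\circ((\mu_H\circ(H\otimes m_H)\circ(\delta_H\otimes H))\otimes H)$; (iii) $m_H\circ(H\otimes\mu_H)=\mu_H\circ(m_H\otimes m_H)\circ(H\otimes c_{H,H}\otimes H)\circ(\delta_H\otimes H\otimes H)$; (iv) $\alpha_H=(H^*\otimes m_H)\circ(c_{H,H^*}\otimes H)\circ(H\otimes a_H):H\to H^*\otimes H$ is convolution invertible, i.e. there is $\beta_H:H\to H^*\otimes H$ with $(H^*\otimes b_H\otimes H)\circ(\alpha_H\otimes\beta_H)\circ\delta_H=\varepsilon_H\otimes a_H=(H^*\otimes b_H\otimes H)\circ(\beta_H\otimes\alpha_H)\circ\delta_H$. It is cocommutative if $H$ is. A morphism of post-Hopf algebras $(H,m_H)\to(B,m_B)$ is a Hopf algebra morphism $f:H\to B$ with $f\circ m_H=m_B\circ(f\otimes f)$. Put $\widetilde{\beta}_H=(b_H\otimes H)\circ(H\otimes\beta_H):H\otimes H\to H$. Condition $(\star)$ is: $\delta_H\circ\widetilde{\beta}_H=(\widetilde{\beta}_H\otimes\widetilde{\beta}_H)\circ(H\otimes c_{H,H}\otimes H)\circ(\delta_H\otimes\delta_H)$.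 $\mathsf{cocPost}\text{-}\mathsf{Hopf}^{\star}$ is the full subcategory of post-Hopf algebras that are cocommutative and satisfy $(\star)$. Brace triple: $(H,\gamma_H,T_H)$ with $H=(H,\eta_H,\mu_H,\varepsilon_H,\delta_H,\lambda_H)$ a Hopf algebra in $\mathsf{C}$ with $\lambda_H$ an isomorphism, and morphisms $\gamma_H:H\otimes H\to H$, $T_H:H\to H$ such that (i) $(\gamma_H\otimes H)\circ(H\otimes c_{H,H})\circ(\delta_H\otimes H)=(\gamma_H\otimes H)\circ(H\otimes c_{H,H})\circ((c_{H,H}\circ\delta_H)\otimes H)$; (ii) $\gamma_H$ is a coalgebra morphism; (iii) $\gamma_H\circ(H\otimes\mu_H)=\mu_H\circ(\gamma_H\otimes\gamma_H)\circ(H\otimes c_{H,H}\otimes H)\circ(\delta_H\otimes H\otimes H)$; (iv) $\gamma_H\circ(H\otimes\gamma_H)=\gamma_H\circ((\mu_H\circ(H\otimes\gamma_H)\circ(\delta_H\otimes H))\otimes H)$; (v) $\gamma_H\circ(\eta_H\otimes H)=id_H$; (vi) $T_H$ is an isomorphism with (vi.1) $\delta_H\circ T_H=c_{H,H}\circ(T_H\otimes T_H)\circ\delta_H$, (vi.2) $\varepsilon_H\circ T_H=\varepsilon_H$, (vi.3) $\mu_H\circ(H\otimes\gamma_H)\circ((\delta_H\circ T_H)\otimes H)=\mu_H\circ(H\otimes\gamma_H)\circ(((T_H\otimes T_H)\circ\delta_H)\otimes H)$, (vi.4) $\gamma_H\circ(H\otimes T_H)\circ\delta_H=\lambda_H$,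 (vi.5) $\gamma_H\circ(T_H\otimes H)\circ\delta_H=\lambda_H^{-1}\circ T_H$. A morphism of brace triples $(H,\gamma_H,T_H)\to(B,\gamma_B,T_B)$ is a Hopf algebra morphism $f:H\to B$ with $f\circ\gamma_H=\gamma_B\circ(f\otimes f)$. $\mathsf{cocBT^{f}}$ is the full subcategory of brace triples whose underlying Hopf algebra is finite and cocommutative. *)

(* Defs.v *)
From Stdlib Require Import ProofIrrelevance.

Set Implicit Arguments.
Unset Strict Implicit.
Unset Printing Implicit Defensive.

Declare Scope cat_scope.
Delimit Scope cat_scope with cat.
Local Open Scope cat_scope.

Record category := Category {
  Ob :> Type;
  Hom : Ob -> Ob -> Type;
  idm : forall X : Ob, Hom X X;
  comp : forall X Y Z : Ob, Hom Y Z -> Hom X Y -> Hom X Z;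
  compA : forall (X Y Z W : Ob) (h : Hom Z W) (g : Hom Y Z) (f : Hom X Y),
    comp h (comp g f) = comp (comp h g) f;
  comp1f : forall (X Y : Ob) (f : Hom X Y), comp (idm Y) f = f;
  compf1 : forall (X Y : Ob) (f : Hom X Y), comp f (idm X) = f
}.

Arguments Hom {c} X Y.
Arguments idm {c} X.
Arguments comp {c X Y Z} g f : rename.

Notation "g ∘ f" := (comp g f) (at level 40, left associativity) : cat_scope.

(* The identity morphism, seen as a morphism between two equal objects. *)
Definition idto {C : category} {X Y : C} (e : X = Y) : Hom X Y :=
  match e in _ = Z return Hom X Z with eq_refl => idm X end.

Record is_inverse {C : category} {X Y : C} (f : Hom X Y) (g : Hom Y X) : Prop :=
  IsInverse { inv_l : g ∘ f = idm X; inv_r : f ∘ g = idm Y }.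

Definition is_iso {C : category} {X Y : C} (f : Hom X Y) : Prop :=
  exists g : Hom Y X, is_inverse f g.

Record functor (C D : category) := Functor {
  fob :> C -> D;
  fmap : forall X Y : C, Hom X Y -> Hom (fob X) (fob Y);
  fmap_id : forall X : C, fmap (idm X) = idm (fob X);
  fmap_comp : forall (X Y Z : C) (g : Hom Y Z) (f : Hom X Y),
    fmap (g ∘ f) = fmap g ∘ fmap f
}.

Arguments fmap {C D} f {X Y} _ : rename.

Definition functor_id (C : category) : functor C C :=
  {| fob := fun X => X;
     fmap := fun X Y f => f;
     fmap_id := fun X => eq_refl;
     fmap_comp := fun X Y Z g f => eq_refl |}.

Definition functor_comp (C D E : category) (G : functor D E) (F : functor C D) :
  functor C E.
Proof.
  refine {| fob := fun X => G (F X); fmap := fun X Y f => fmap G (fmap F f) |}.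
  - intro X. rewrite fmap_id. apply fmap_id.
  - intros X Y Z g f. rewrite fmap_comp. apply fmap_comp.
Defined.

(* Equality of functors: equal on objects (as elements of the type of objects,
   not merely isomorphic), and equal on morphisms along these equalities. *)
Definition functor_eq (C D : category) (F G : functor C D) : Prop :=
  exists e : forall X : C, F X = G X,
    forall (X Y : C) (f : Hom X Y),
      idto (e Y) ∘ fmap F f = fmap G f ∘ idto (e X).

Definition isomorphic_categories (C D : category) : Prop :=
  exists (F : functor C D) (G : functor D C),
    functor_eq (functor_comp G F) (functor_id C) /\
    functor_eq (functor_comp F G) (functor_id D).

Definition full_subcategory (C : category) (P : C -> Prop) : category :=
  {| Ob := {X : C | P X};
     Hom := fun X Y => Hom (proj1_sig X) (proj1_sig Y);
     idm := fun X => idm (proj1_sig X);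
     comp := fun X Y Z g f => g ∘ f;
     compA := fun X Y Z W h g f => compA h g f;
     comp1f := fun X Y f => comp1f f;
     compf1 := fun X Y f => compf1 f |}.

(* Strictness is associativity and unitality of the tensor product as equalities
   of objects and of morphisms; the latter compare morphisms of propositionally
   equal types, hence are stated along [idto].  The pentagon and triangle
   identities are not fields: their sides are of the form [idto e], so they hold
   by uniqueness of identity proofs. *)
Record strict_monoidal_category := StrictMonoidal {
  smcat :> category;
  unit_ob : smcat;
  tens : smcat -> smcat -> smcat;
  tensm : forall X Y X' Y' : smcat,
    Hom X Y -> Hom X' Y' -> Hom (tens X X') (tens Y Y');
  tensm_id : forall X Y : smcat, tensm (idm X) (idm Y) = idm (tens X Y);
  tensm_comp : forall (X Y Z X' Y' Z' : smcat)
      (g : Hom Y Z) (f : Hom X Y) (g' : Hom Y' Z') (f' : Hom X' Y'),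
    tensm (g ∘ f) (g' ∘ f') = tensm g g' ∘ tensm f f';
  tensA : forall X Y Z : smcat, tens (tens X Y) Z = tens X (tens Y Z);
  tens1o : forall X : smcat, tens unit_ob X = X;
  tenso1 : forall X : smcat, tens X unit_ob = X;
  tensmA : forall (X Y Z X' Y' Z' : smcat)
      (f : Hom X X') (g : Hom Y Y') (h : Hom Z Z'),
    idto (tensA X' Y' Z') ∘ tensm (tensm f g) h =
    tensm f (tensm g h) ∘ idto (tensA X Y Z);
  tensm1o : forall (X Y : smcat) (f : Hom X Y),
    idto (tens1o Y) ∘ tensm (idm unit_ob) f = f ∘ idto (tens1o X);
  tensmo1 : forall (X Y : smcat) (f : Hom X Y),
    idto (tenso1 Y) ∘ tensm f (idm unit_ob) = f ∘ idto (tenso1 X)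
}.

Arguments unit_ob {s}.
Arguments tens {s} X Y : rename.
Arguments tensm {s X Y X' Y'} f g : rename.

Notation "X ⊗ Y" := (tens X Y) (at level 35, right associativity) : cat_scope.
Notation "f ⊠ g" := (tensm f g) (at level 35, right associativity) : cat_scope.
Notation "P ◁ f" := (tensm (idm P) f) (at level 35, right associativity) : cat_scope.
Notation "f ▷ P" := (tensm f (idm P)) (at level 34, left associativity) : cat_scope.

(* The identities that strictness leaves implicit in a formula. *)
Section StrictnessIdentities.
Context {C : strict_monoidal_category} {X Y Z : C}.
Definition assoc : Hom ((X ⊗ Y) ⊗ Z) (X ⊗ (Y ⊗ Z)) := idto (tensA X Y Z).
Definition assoc' : Hom (X ⊗ (Y ⊗ Z)) ((X ⊗ Y) ⊗ Z) := idto (eq_sym (tensA X Y Z)).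
Definition lunit : Hom (unit_ob ⊗ X) X := idto (tens1o X).
Definition lunit' : Hom X (unit_ob ⊗ X) := idto (eq_sym (tens1o X)).
Definition runit : Hom (X ⊗ unit_ob) X := idto (tenso1 X).
Definition runit' : Hom X (X ⊗ unit_ob) := idto (eq_sym (tenso1 X)).
End StrictnessIdentities.

Record strict_braided_category := StrictBraided {
  sbcat :> strict_monoidal_category;
  braid : forall X Y : sbcat, Hom (X ⊗ Y) (Y ⊗ X);
  braid_iso : forall X Y : sbcat, is_iso (braid X Y);
  braid_nat : forall (X Y X' Y' : sbcat) (f : Hom X X') (g : Hom Y Y'),
    braid X' Y' ∘ (f ⊠ g) = (g ⊠ f) ∘ braid X Y;
  braid_tensr : forall X Y Z : sbcat,
    braid X (Y ⊗ Z) =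
    assoc' ∘ (Y ◁ braid X Z) ∘ assoc ∘ (braid X Y ▷ Z) ∘ assoc';
  braid_tensl : forall X Y Z : sbcat,
    braid (X ⊗ Y) Z =
    assoc ∘ (braid X Z ▷ Y) ∘ assoc' ∘ (X ◁ braid Y Z) ∘ assoc
}.

Arguments braid {s} X Y : rename.

(* A [C]-adjunction [P ⊗ - ⊣ Q ⊗ -]: [C] acts on itself by tensoring on the
   right, and the unit and counit are compatible with this action. *)
Record c_adjunction {C : strict_monoidal_category} (P Q : C) := CAdjunction {
  adj_unit : forall X : C, Hom X (Q ⊗ (P ⊗ X));
  adj_counit : forall X : C, Hom (P ⊗ (Q ⊗ X)) X;
  adj_unit_nat : forall (X Y : C) (f : Hom X Y),
    adj_unit Y ∘ f = (Q ◁ (P ◁ f)) ∘ adj_unit X;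
  adj_counit_nat : forall (X Y : C) (f : Hom X Y),
    adj_counit Y ∘ (P ◁ (Q ◁ f)) = f ∘ adj_counit X;
  adj_triangle_l : forall X : C,
    adj_counit (P ⊗ X) ∘ (P ◁ adj_unit X) = idm (P ⊗ X);
  adj_triangle_r : forall X : C,
    (Q ◁ adj_counit X) ∘ adj_unit (Q ⊗ X) = idm (Q ⊗ X);
  adj_unit_tens : forall X Y : C,
    adj_unit (X ⊗ Y) = (Q ◁ assoc) ∘ assoc ∘ (adj_unit X ▷ Y);
  adj_counit_tens : forall X Y : C,
    adj_counit (X ⊗ Y) ∘ ((P ◁ assoc) ∘ assoc) = adj_counit X ▷ Y
}.

Record dual {C : strict_monoidal_category} (P : C) := Dual {
  dual_ob :> C;
  dual_adj : c_adjunction P dual_ob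
}.

Definition finite {C : strict_monoidal_category} (P : C) : Prop :=
  inhabited (dual P).

Definition coev {C : strict_monoidal_category} {P : C} (D : dual P) :
    Hom unit_ob (D ⊗ P) :=
  (D ◁ runit) ∘ adj_unit (dual_adj D) unit_ob.

Definition ev {C : strict_monoidal_category} {P : C} (D : dual P) :
    Hom (P ⊗ D) unit_ob :=
  adj_counit (dual_adj D) unit_ob ∘ (P ◁ runit').

Section Algebra.
Context {C : strict_braided_category}.
Implicit Types A B D E : C.

Record is_algebra {A} (eta : Hom unit_ob A) (mu : Hom (A ⊗ A) A) : Prop :=
  IsAlgebra {
    alg_unitl : mu ∘ (eta ▷ A) ∘ lunit' = idm A;
    alg_unitr : mu ∘ (A ◁ eta) ∘ runit' = idm A;
    alg_assoc : mu ∘ (mu ▷ A) = mu ∘ (A ◁ mu) ∘ assoc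
  }.

Record is_coalgebra {D} (eps : Hom D unit_ob) (delta : Hom D (D ⊗ D)) : Prop :=
  IsCoalgebra {
    coalg_counitl : lunit ∘ (eps ▷ D) ∘ delta = idm D;
    coalg_counitr : runit ∘ (D ◁ eps) ∘ delta = idm D;
    coalg_coassoc : assoc ∘ (delta ▷ D) ∘ delta = (D ◁ delta) ∘ delta
  }.

Record is_algebra_morphism {A B}
    (etaA : Hom unit_ob A) (muA : Hom (A ⊗ A) A)
    (etaB : Hom unit_ob B) (muB : Hom (B ⊗ B) B) (f : Hom A B) : Prop :=
  IsAlgebraMorphism {
    algm_unit : f ∘ etaA = etaB;
    algm_mul : f ∘ muA = muB ∘ (f ⊠ f)
  }.

Record is_coalgebra_morphism {D E}
    (epsD : Hom D unit_ob) (deltaD : Hom D (D ⊗ D))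
    (epsE : Hom E unit_ob) (deltaE : Hom E (E ⊗ E)) (f : Hom D E) : Prop :=
  IsCoalgebraMorphism {
    coalgm_counit : epsE ∘ f = epsD;
    coalgm_comul : deltaE ∘ f = (f ⊠ f) ∘ deltaD
  }.

(* [A ⊗ c_{B,D} ⊗ E] *)
Definition mid_braid A B D E : Hom ((A ⊗ B) ⊗ (D ⊗ E)) ((A ⊗ D) ⊗ (B ⊗ E)) :=
  assoc' ∘ (A ◁ (assoc ∘ (braid B D ▷ E) ∘ assoc')) ∘ assoc.

Definition tens_unit {A B} (etaA : Hom unit_ob A) (etaB : Hom unit_ob B) :
    Hom unit_ob (A ⊗ B) :=
  (etaA ⊠ etaB) ∘ lunit'.

Definition tens_mul {A B} (muA : Hom (A ⊗ A) A) (muB : Hom (B ⊗ B) B) :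
    Hom ((A ⊗ B) ⊗ (A ⊗ B)) (A ⊗ B) :=
  (muA ⊠ muB) ∘ mid_braid A B A B.

Definition tens_counit {D E} (epsD : Hom D unit_ob) (epsE : Hom E unit_ob) :
    Hom (D ⊗ E) unit_ob :=
  lunit ∘ (epsD ⊠ epsE).

Definition tens_comul {D E} (deltaD : Hom D (D ⊗ D)) (deltaE : Hom E (E ⊗ E)) :
    Hom (D ⊗ E) ((D ⊗ E) ⊗ (D ⊗ E)) :=
  mid_braid D D E E ∘ (deltaD ⊠ deltaE).

End Algebra.

Record hopf_algebra (C : strict_braided_category) := HopfAlgebra {
  hcar :> C;
  eta : Hom unit_ob hcar;
  mu : Hom (hcar ⊗ hcar) hcar;
  eps : Hom hcar unit_ob;
  delta : Hom hcar (hcar ⊗ hcar);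
  lam : Hom hcar hcar;
  hopf_algebraP : is_algebra eta mu;
  hopf_coalgebraP : is_coalgebra eps delta;
  hopf_eps_morph : is_algebra_morphism eta mu (idm unit_ob) lunit eps;
  hopf_delta_morph :
    is_algebra_morphism eta mu (tens_unit eta eta) (tens_mul mu mu) delta;
  hopf_antipode_r : mu ∘ (hcar ◁ lam) ∘ delta = eta ∘ eps;
  hopf_antipode_l : mu ∘ (lam ▷ hcar) ∘ delta = eta ∘ eps
}.

Arguments eta {C} h : rename.
Arguments mu {C} h : rename.
Arguments eps {C} h : rename.
Arguments delta {C} h : rename.
Arguments lam {C} h : rename.

Section Structures.
Context {C : strict_braided_category}.
Implicit Types H B E : hopf_algebra C.

Definition cocommutative H : Prop := braid H H ∘ delta H = delta H.

Record is_hopf_morphism H B (f : Hom H B) : Prop := IsHopfMorphism {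
  hopfm_alg : is_algebra_morphism (eta H) (mu H) (eta B) (mu B) f;
  hopfm_coalg : is_coalgebra_morphism (eps H) (delta H) (eps B) (delta B) f
}.

Definition is_tensor_coalgebra_morphism H (g : Hom (H ⊗ H) H) : Prop :=
  is_coalgebra_morphism (tens_counit (eps H) (eps H))
    (tens_comul (delta H) (delta H)) (eps H) (delta H) g.

(* [mu ∘ (H ⊗ g) ∘ (delta ⊗ H)], in Sweedler notation x ⊗ y |-> x_1 g(x_2 ⊗ y) *)
Definition sub_mul H (g : Hom (H ⊗ H) H) : Hom (H ⊗ H) H :=
  mu H ∘ (H ◁ g) ∘ assoc ∘ (delta H ▷ H).

(* [g ∘ (H ⊗ mu) = mu ∘ (g ⊗ g) ∘ (H ⊗ c ⊗ H) ∘ (delta ⊗ H ⊗ H)] *)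
Definition distributes_over_mul H (g : Hom (H ⊗ H) H) : Prop :=
  g ∘ (H ◁ mu H) =
  mu H ∘ (g ⊠ g) ∘ mid_braid H H H H ∘ (delta H ▷ (H ⊗ H)).

Definition alpha H (m : Hom (H ⊗ H) H) (D : dual (hcar H)) : Hom H (D ⊗ H) :=
  (D ◁ m) ∘ assoc ∘ (braid H D ▷ H) ∘ assoc' ∘ (H ◁ coev D) ∘ runit'.

Definition convolution H (D : dual (hcar H)) (f g : Hom H (D ⊗ H)) : Hom H (D ⊗ H) :=
  (D ◁ (lunit ∘ (ev D ▷ H) ∘ assoc')) ∘ assoc ∘ (f ⊠ g) ∘ delta H.

Record is_convolution_inverse H (D : dual (hcar H)) (f g : Hom H (D ⊗ H)) : Prop :=
  IsConvolutionInverse {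
    conv_inv_r : convolution f g = lunit ∘ (eps H ⊠ coev D) ∘ runit';
    conv_inv_l : convolution g f = lunit ∘ (eps H ⊠ coev D) ∘ runit'
  }.

(* The acted-on argument of [beta_tilde] is the first one. *)
Definition beta_tilde H (D : dual (hcar H)) (beta : Hom H (D ⊗ H)) : Hom (H ⊗ H) H :=
  lunit ∘ (ev D ▷ H) ∘ assoc' ∘ (H ◁ beta).

(* A dual is unique up to isomorphism, and the convolution invertibility of
   [alpha] does not depend on it; quantifying over all duals of the finite
   object [H] avoids making a choice of dual part of the structure. *)
Record is_post_hopf H (m : Hom (H ⊗ H) H) : Prop := IsPostHopf {
  post_finite : finite (hcar H);
  post_coalg : is_tensor_coalgebra_morphism m;
  post_assoc : m ∘ (H ◁ m) = m ∘ (sub_mul m ▷ H) ∘ assoc';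
  post_distr : distributes_over_mul m;
  post_conv : forall D : dual (hcar H),
    exists beta : Hom H (D ⊗ H), is_convolution_inverse (alpha m D) beta
}.

(* [beta] is unique for each dual [D], and [beta_tilde beta] is the same
   morphism for all duals. *)
Definition star H (m : Hom (H ⊗ H) H) : Prop :=
  forall (D : dual (hcar H)) (beta : Hom H (D ⊗ H)),
    is_convolution_inverse (alpha m D) beta ->
    delta H ∘ beta_tilde beta =
    (beta_tilde beta ⊠ beta_tilde beta) ∘ mid_braid H H H H ∘ (delta H ⊠ delta H).

Record is_brace_triple H (gamma : Hom (H ⊗ H) H) (T : Hom H H) : Prop :=
  IsBraceTriple {
    brace_lam_iso : is_iso (lam H);
    brace_coc :
      (gamma ▷ H) ∘ assoc' ∘ (H ◁ braid H H) ∘ assoc ∘ (delta H ▷ H) =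
      (gamma ▷ H) ∘ assoc' ∘ (H ◁ braid H H) ∘ assoc ∘ ((braid H H ∘ delta H) ▷ H);
    brace_coalg : is_tensor_coalgebra_morphism gamma;
    brace_distr : distributes_over_mul gamma;
    brace_assoc : gamma ∘ (H ◁ gamma) = gamma ∘ (sub_mul gamma ▷ H) ∘ assoc';
    brace_unit : gamma ∘ (eta H ▷ H) ∘ lunit' = idm H;
    brace_T_iso : is_iso T;
    brace_T_delta : delta H ∘ T = braid H H ∘ (T ⊠ T) ∘ delta H;
    brace_T_eps : eps H ∘ T = eps H;
    brace_T_mul :
      mu H ∘ (H ◁ gamma) ∘ assoc ∘ ((delta H ∘ T) ▷ H) =
      mu H ∘ (H ◁ gamma) ∘ assoc ∘ (((T ⊠ T) ∘ delta H) ▷ H);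
    brace_T_r : gamma ∘ (H ◁ T) ∘ delta H = lam H;
    brace_T_l : forall laminv : Hom H H, is_inverse (lam H) laminv ->
      gamma ∘ (T ▷ H) ∘ delta H = laminv ∘ T
  }.

Definition is_op_morphism H B (g : Hom (H ⊗ H) H) (h : Hom (B ⊗ B) B)
    (f : Hom H B) : Prop :=
  is_hopf_morphism f /\ f ∘ g = h ∘ (f ⊠ f).

Lemma is_op_morphism_id H (g : Hom (H ⊗ H) H) : is_op_morphism g g (idm H).
Proof.
  repeat split; rewrite ?tensm_id, ?comp1f, ?compf1; reflexivity.
Qed.

Lemma is_op_morphism_comp H B E (gH : Hom (H ⊗ H) H) (gB : Hom (B ⊗ B) B)
    (gE : Hom (E ⊗ E) E) (g : Hom B E) (f : Hom H B) :
  is_op_morphism gB gE g -> is_op_morphism gH gB f -> is_op_morphism gH gE (g ∘ f).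
Proof.
  intros [[[gu gm] [gc gd]] go] [[[fu fm] [fc fd]] fo].
  repeat split.
  - now rewrite <- compA, fu.
  - now rewrite tensm_comp, <- compA, fm, !compA, gm.
  - now rewrite compA, gc.
  - now rewrite tensm_comp, compA, gd, <- !compA, fd.
  - now rewrite tensm_comp, <- compA, fo, !compA, go.
Qed.

End Structures.

Record post_hopf (C : strict_braided_category) := PostHopf {
  post_hopf_alg :> hopf_algebra C;
  post_op : Hom (post_hopf_alg ⊗ post_hopf_alg) post_hopf_alg;
  post_hopfP : is_post_hopf post_op
}.

Record brace_triple (C : strict_braided_category) := BraceTriple {
  brace_hopf_alg :> hopf_algebra C;
  brace_op : Hom (brace_hopf_alg ⊗ brace_hopf_alg) brace_hopf_alg;
  brace_T : Hom brace_hopf_alg brace_hopf_alg;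
  brace_tripleP : is_brace_triple brace_op brace_T
}.

(* Both categories have Hopf algebra morphisms compatible with an operation,
   the operation being selected by [op]. *)
Section OpCategory.
Variables (C : strict_braided_category) (X : Type) (alg : X -> hopf_algebra C).
Variable op : forall x : X, Hom (alg x ⊗ alg x) (alg x).

Definition op_hom (x y : X) : Type :=
  {f : Hom (alg x) (alg y) | is_op_morphism (op x) (op y) f}.

Definition op_id (x : X) : op_hom x x := exist _ _ (is_op_morphism_id (op x)).

Definition op_comp (x y z : X) (g : op_hom y z) (f : op_hom x y) : op_hom x z :=
  exist _ _ (is_op_morphism_comp (proj2_sig g) (proj2_sig f)).

Definition op_category : category.
Proof.
  refine {| Ob := X; Hom := op_hom; idm := op_id; comp := op_comp |}.
  - intros x y z w h g f. apply subset_eq_compat. apply compA.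
  - intros x y [f Hf]. apply subset_eq_compat. apply comp1f.
  - intros x y [f Hf]. apply subset_eq_compat. apply compf1.
Defined.
End OpCategory.

Definition Post_Hopf (C : strict_braided_category) : category :=
  op_category (@post_op C).

Definition Brace_Triple (C : strict_braided_category) : category :=
  op_category (@brace_op C).

Definition cocPost_Hopf_star (C : strict_braided_category) : category :=
  @full_subcategory (Post_Hopf C)
    (fun X : post_hopf C => cocommutative X /\ star (post_op X)).

Definition cocBT_f (C : strict_braided_category) : category :=
  @full_subcategory (Brace_Triple C)
    (fun X : brace_triple C => finite (hcar X) /\ cocommutative X).

(* Main.v *)
(** In a braided category, a cocommutative Hopf algebra [H] has an involutive
    self-braiding, so its coalgebra endomorphisms form a group for the convolution
    product, on which an operation [m] acts as in a post-group. The morphisms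
    [H ⊗ H -> H] form a monoid for [(φψ)(x, y) = φ(x_1, ψ(x_2, y))], and for any dual
    of [H] the convolution inverse of [alpha] is, after precomposing [beta_tilde]
    with the braiding, a two-sided inverse [b] of [m] in this monoid; condition
    (star) says that [b] is comultiplicative. Then [T(x) = b(x_1, λ(x_2))] is the inverse of
    [x] for the group law [x_1 m(x_2, y)], which gives the brace triple; conversely
    [b(x, y) = m(T(x), y)] inverts [m]. Either of [b] and [T] is determined by [m],
    so both constructions are the identity on the underlying operations.

    Diagrams are handled without associators by replacing a morphism
    [X ⊗ Y -> Z] by the natural family [X ⊗ (Y ⊗ R) -> Z ⊗ R], and similarly for
    other arities: this embeds the category in its endofunctors [X ⊗ -]. *)
From Corelib Require Import ssreflect.
From Stdlib Require Import ProofIrrelevance IndefiniteDescription.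
Require Import Defs.
Set Implicit Arguments.
Unset Strict Implicit.
Unset Printing Implicit Defensive.
Local Open Scope cat_scope.

(** * Composition with casts along equalities of objects *)

Section Composition.
Context {C : category}.

Lemma idto_irrel {X Y : C} (e e' : X = Y) : idto e = idto e'.
Proof. by rewrite (proof_irrelevance _ e e'). Qed.

Lemma idto_idm {X : C} (e : X = X) : idto e = idm X.
Proof. exact: (idto_irrel e eq_refl). Qed.

Lemma idto_comp {X Y Z : C} (e : X = Y) (e' : Y = Z) :
  idto e' ∘ idto e = idto (eq_trans e e').
Proof. case: _ / e'; exact: comp1f. Qed.

Lemma idto_compA {W X Y Z : C} (e : X = Y) (e' : Y = Z) (f : Hom W X) :
  idto e' ∘ (idto e ∘ f) = idto (eq_trans e e') ∘ f.
Proof. by rewrite compA idto_comp. Qed.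

Lemma idto_id_comp {X Y : C} (e : Y = Y) (f : Hom X Y) : idto e ∘ f = f.
Proof. by rewrite idto_idm comp1f. Qed.

Lemma idto_comp_id {X Y : C} (e : X = X) (f : Hom X Y) : f ∘ idto e = f.
Proof. by rewrite idto_idm compf1. Qed.

Lemma idto_cancel_l {X Y Z : C} (e : Y = Z) (f g : Hom X Y) :
  idto e ∘ f = idto e ∘ g -> f = g.
Proof. by case: _ / e; rewrite !comp1f. Qed.

Lemma idto_cancel_r {X Y Z : C} (e : X = Y) (f g : Hom Y Z) :
  f ∘ idto e = g ∘ idto e -> f = g.
Proof. by case: _ / e f g => f g; rewrite !compf1. Qed.

Lemma inverse_unique {X Y : C} (f : Hom X Y) (g g' : Hom Y X) :
  is_inverse f g -> is_inverse f g' -> g = g'.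
Proof.
by move=> [gf _] [_ fg']; rewrite -(compf1 g) -fg' compA gf comp1f.
Qed.

(** Composites are kept nested to the right, so a rule for a composite must also match when a
    further morphism [s] stands to its right; this and its longer variants produce that form. *)
Lemma comp_eq2 {W X Y Z : C} {a : Hom Y Z} {b : Hom X Y} {r : Hom X Z} :
  a ∘ b = r -> forall s : Hom W X, a ∘ (b ∘ s) = r ∘ s.
Proof. by move=> E s; rewrite compA E. Qed.

Lemma comp_eq3 {W X Y Z U : C} {a : Hom Y Z} {b : Hom X Y} {c : Hom U X} {r : Hom U Z} :
  a ∘ (b ∘ c) = r -> forall s : Hom W U, a ∘ (b ∘ (c ∘ s)) = r ∘ s.
Proof. by move=> E s; rewrite -E -!compA. Qed.

Lemma comp_eq4 {W X Y Z U V : C} {a : Hom Y Z} {b : Hom X Y} {c : Hom U X}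
    {d : Hom V U} {r : Hom V Z} :
  a ∘ (b ∘ (c ∘ d)) = r -> forall s : Hom W V, a ∘ (b ∘ (c ∘ (d ∘ s))) = r ∘ s.
Proof. by move=> E s; rewrite -E -!compA. Qed.

Lemma comp_eq5 {W X Y Z U V V' : C} {a : Hom Y Z} {b : Hom X Y} {c : Hom U X}
    {d : Hom V U} {d' : Hom V' V} {r : Hom V' Z} :
  a ∘ (b ∘ (c ∘ (d ∘ d'))) = r ->
  forall s : Hom W V', a ∘ (b ∘ (c ∘ (d ∘ (d' ∘ s)))) = r ∘ s.
Proof. by move=> E s; rewrite -E -!compA. Qed.

End Composition.

(** * Whiskering, and moving casts out of it *)

Section Whiskering.
Context {C : strict_monoidal_category}.
Implicit Types X Y Z R : C.

Lemma whl_comp P X Y Z (g : Hom Y Z) (f : Hom X Y) :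
  P ◁ (g ∘ f) = (P ◁ g) ∘ (P ◁ f).
Proof. by rewrite -tensm_comp comp1f. Qed.

Lemma whr_comp P X Y Z (g : Hom Y Z) (f : Hom X Y) :
  (g ∘ f) ▷ P = (g ▷ P) ∘ (f ▷ P).
Proof. by rewrite -tensm_comp comp1f. Qed.

Lemma tens_split_r X Y X' Y' (f : Hom X X') (g : Hom Y Y') :
  f ⊠ g = (f ▷ Y') ∘ (X ◁ g).
Proof. by rewrite -tensm_comp comp1f compf1. Qed.

Lemma tens_split_l X Y X' Y' (f : Hom X X') (g : Hom Y Y') :
  f ⊠ g = (X' ◁ g) ∘ (f ▷ Y).
Proof. by rewrite -tensm_comp comp1f compf1. Qed.

Lemma wh_swap X Y X' Y' (f : Hom X X') (g : Hom Y Y') :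
  (f ▷ Y') ∘ (X ◁ g) = (X' ◁ g) ∘ (f ▷ Y).
Proof. by rewrite -tens_split_r tens_split_l. Qed.

Lemma whl_idto P X Y (e : X = Y) : P ◁ idto e = idto (f_equal (tens P) e).
Proof. case: _ / e; exact: tensm_id. Qed.

Lemma whr_idto P X Y (e : X = Y) : idto e ▷ P = idto (f_equal (fun Z => Z ⊗ P) e).
Proof. case: _ / e; exact: tensm_id. Qed.

Lemma whr_whr X Y A R (f : Hom X Y) :
  f ▷ A ▷ R =
  idto (eq_sym (tensA Y A R)) ∘ ((f ▷ (A ⊗ R)) ∘ idto (tensA X A R)).
Proof.
by rewrite -tensm_id -tensmA idto_compA idto_id_comp.
Qed.

Lemma whl_whr X Y A R (f : Hom X Y) :
  (A ◁ f) ▷ R =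
  idto (eq_sym (tensA A Y R)) ∘ ((A ◁ (f ▷ R)) ∘ idto (tensA A X R)).
Proof. by rewrite -tensmA idto_compA idto_id_comp. Qed.

Lemma whl_tens X Y A B (f : Hom X Y) :
  (A ⊗ B) ◁ f =
  idto (eq_sym (tensA A B Y)) ∘ ((A ◁ (B ◁ f)) ∘ idto (tensA A B X)).
Proof. by rewrite -tensmA idto_compA idto_id_comp tensm_id. Qed.

Lemma whl_unit X Y (f : Hom X Y) :
  unit_ob ◁ f = idto (eq_sym (tens1o Y)) ∘ (f ∘ idto (tens1o X)).
Proof. by rewrite -tensm1o idto_compA idto_id_comp. Qed.

Lemma whr_unit X Y (f : Hom X Y) :
  f ▷ unit_ob = idto (eq_sym (tenso1 Y)) ∘ (f ∘ idto (tenso1 X)).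
Proof. by rewrite -tensmo1 idto_compA idto_id_comp. Qed.

(** Whiskering objects that are equal only propositionally, such as (A ⊗ B) ⊗ R and A ⊗ (B ⊗ R),
    block the comparison made by [strict]; here the difference is moved into casts. *)
Lemma whr_ob X Y A B (e : A = B) (f : Hom X Y) :
  f ▷ A = idto (f_equal (tens Y) (eq_sym e)) ∘ ((f ▷ B) ∘ idto (f_equal (tens X) e)).
Proof. by case: _ / e; rewrite idto_id_comp idto_comp_id. Qed.

Lemma whr_inj X Y (f g : Hom X Y) : f ▷ unit_ob = g ▷ unit_ob -> f = g.
Proof.
rewrite !whr_unit => /idto_cancel_l; exact: idto_cancel_r.
Qed.

End Whiskering.

Ltac cast_simp :=
  rewrite /assoc /assoc' /lunit /lunit' /runit /runit';
  rewrite ?(whl_comp, whr_comp);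
  rewrite -?compA;
  rewrite ?(tensm_id, whl_idto, whr_idto, whr_whr, whl_whr, whl_tens, whl_unit,
            whr_unit, whl_comp, whr_comp, comp1f, compf1);
  rewrite -?compA;
  rewrite ?(idto_compA, idto_comp);
  rewrite ?(idto_id_comp, idto_comp_id).

Ltac cast_congr :=
  repeat (first [ reflexivity
                | exact: idto_irrel | exact: idto_idm | exact: (eq_sym (idto_idm _))
                | apply: f_equal2 ]).

(* Proves equality of composites up to reassociation and [idto]s: the latter are
   pushed outwards and merged, then compared by proof irrelevance. *)
Ltac strict := repeat (progress cast_simp); cast_congr.

(** * Morphisms as natural families on tensor products *)

Section Lifts.
Context {C : strict_monoidal_category}.
Implicit Types X Y Z W R : C.

(* [locked] prevents [compA] from matching inside a lift. *)
Definition lift21 X Y Z (f : Hom (X ⊗ Y) Z) R : Hom (X ⊗ (Y ⊗ R)) (Z ⊗ R) :=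
  locked ((f ▷ R) ∘ assoc').
Definition lift12 X Y Z (f : Hom X (Y ⊗ Z)) R : Hom (X ⊗ R) (Y ⊗ (Z ⊗ R)) :=
  locked (assoc ∘ (f ▷ R)).
Definition lift22 X Y Z W (f : Hom (X ⊗ Y) (Z ⊗ W)) R :
    Hom (X ⊗ (Y ⊗ R)) (Z ⊗ (W ⊗ R)) :=
  locked (assoc ∘ (f ▷ R) ∘ assoc').
Definition lift01 X (f : Hom unit_ob X) R : Hom R (X ⊗ R) :=
  locked ((f ▷ R) ∘ lunit').
Definition lift10 X (f : Hom X unit_ob) R : Hom (X ⊗ R) R :=
  locked (lunit ∘ (f ▷ R)).

Lemma lift21E X Y Z (f : Hom (X ⊗ Y) Z) R : lift21 f R = (f ▷ R) ∘ assoc'.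
Proof. by rewrite /lift21 -lock. Qed.

Lemma lift12E X Y Z (f : Hom X (Y ⊗ Z)) R : lift12 f R = assoc ∘ (f ▷ R).
Proof. by rewrite /lift12 -lock. Qed.

Lemma lift22E X Y Z W (f : Hom (X ⊗ Y) (Z ⊗ W)) R :
  lift22 f R = assoc ∘ (f ▷ R) ∘ assoc'.
Proof. by rewrite /lift22 -lock. Qed.

Lemma lift01E X (f : Hom unit_ob X) R : lift01 f R = (f ▷ R) ∘ lunit'.
Proof. by rewrite /lift01 -lock. Qed.

Lemma lift10E X (f : Hom X unit_ob) R : lift10 f R = lunit ∘ (f ▷ R).
Proof. by rewrite /lift10 -lock. Qed.

Lemma whr_nat X Y R R' (f : Hom X Y) (s : Hom R R') :
  (Y ◁ s) ∘ (f ▷ R) = (f ▷ R') ∘ (X ◁ s).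
Proof. by rewrite wh_swap. Qed.

Lemma lift21_nat X Y Z (f : Hom (X ⊗ Y) Z) R R' (s : Hom R R') :
  (Z ◁ s) ∘ lift21 f R = lift21 f R' ∘ (X ◁ (Y ◁ s)).
Proof. by rewrite ?lift21E compA whr_nat; strict. Qed.

Lemma lift12_nat X Y Z (f : Hom X (Y ⊗ Z)) R R' (s : Hom R R') :
  (Y ◁ (Z ◁ s)) ∘ lift12 f R = lift12 f R' ∘ (X ◁ s).
Proof.
rewrite ?lift12E -compA -whr_nat; strict.
Qed.

Lemma lift22_nat X Y Z W (f : Hom (X ⊗ Y) (Z ⊗ W)) R R' (s : Hom R R') :
  (Z ◁ (W ◁ s)) ∘ lift22 f R = lift22 f R' ∘ (X ◁ (Y ◁ s)).
Proof.
have -> : X ◁ (Y ◁ s) = assoc ∘ ((X ⊗ Y) ◁ s) ∘ assoc' by strict.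
rewrite ?lift22E.
have -> : assoc ∘ (f ▷ R') ∘ assoc' ∘ (assoc ∘ ((X ⊗ Y) ◁ s) ∘ assoc') =
  assoc ∘ ((f ▷ R') ∘ ((X ⊗ Y) ◁ s)) ∘ assoc' by strict.
rewrite -whr_nat; strict.
Qed.

Lemma lift01_nat X (f : Hom unit_ob X) R R' (s : Hom R R') :
  (X ◁ s) ∘ lift01 f R = lift01 f R' ∘ s.
Proof. rewrite ?lift01E compA whr_nat; strict. Qed.

Lemma lift10_nat X (f : Hom X unit_ob) R R' (s : Hom R R') :
  s ∘ lift10 f R = lift10 f R' ∘ (X ◁ s).
Proof. rewrite ?lift10E -[RHS]compA -whr_nat; strict. Qed.

Lemma lift21_inj X Y Z (f g : Hom (X ⊗ Y) Z) :
  (forall R, lift21 f R = lift21 g R) -> f = g.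
Proof. move=> /(_ unit_ob); by rewrite ?(lift21E, lift12E, lift22E) => /idto_cancel_r /whr_inj. Qed.

Lemma lift22_inj X Y Z W (f g : Hom (X ⊗ Y) (Z ⊗ W)) :
  (forall R, lift22 f R = lift22 g R) -> f = g.
Proof. move=> /(_ unit_ob); by rewrite ?(lift21E, lift12E, lift22E) => /idto_cancel_r /idto_cancel_l /whr_inj. Qed.

Lemma lift12_inj X Y Z (f g : Hom X (Y ⊗ Z)) :
  (forall R, lift12 f R = lift12 g R) -> f = g.
Proof. move=> /(_ unit_ob); by rewrite ?(lift21E, lift12E, lift22E) => /idto_cancel_l /whr_inj. Qed.

End Lifts.

(** * Naturality and hexagons of the braiding for lifts *)

Section BraidLifts.
Context {C : strict_braided_category}.
Implicit Types X Y Z W R : C.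

(** Naturality of the braiding moves [f] across the strand, and a hexagon splits the crossing with Y
    ⊗ Z in two. *)
Lemma braid_lift21_r X Y Z W (f : Hom (Y ⊗ Z) W) R :
  lift22 (braid X W) R ∘ (X ◁ lift21 f R) =
  lift21 f (X ⊗ R) ∘ ((Y ◁ lift22 (braid X Z) R) ∘ lift22 (braid X Y) (Z ⊗ R)).
Proof.
transitivity (assoc ∘ ((braid X W ∘ (X ◁ f)) ▷ R) ∘ assoc' ∘ (X ◁ assoc')).
  by rewrite ?lift22E ?lift21E; strict.
rewrite braid_nat braid_tensr ?lift22E ?lift21E; strict.
Qed.

Lemma braid_lift21_l X Y Z W (f : Hom (Y ⊗ Z) W) R :
  lift22 (braid W X) R ∘ lift21 f (X ⊗ R) =
  (X ◁ lift21 f R) ∘ (lift22 (braid Y X) (Z ⊗ R) ∘ (Y ◁ lift22 (braid Z X) R)).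
Proof.
transitivity (assoc ∘ ((braid W X ∘ (f ▷ X)) ▷ R) ∘ assoc' ∘ assoc').
  by rewrite ?lift22E ?lift21E; strict.
rewrite braid_nat braid_tensl ?lift22E ?lift21E; strict.
Qed.

Lemma braid_lift12_r X Y Z W (f : Hom W (Y ⊗ Z)) R :
  lift12 f (X ⊗ R) ∘ lift22 (braid X W) R =
  (Y ◁ lift22 (braid X Z) R) ∘ (lift22 (braid X Y) (Z ⊗ R) ∘ (X ◁ lift12 f R)).
Proof.
transitivity (assoc ∘ assoc ∘ (((f ▷ X) ∘ braid X W) ▷ R) ∘ assoc').
  by rewrite ?lift22E ?lift12E; strict.
rewrite -braid_nat braid_tensr ?lift22E ?lift12E; strict.
Qed.

Lemma braid_lift12_l X Y Z W (f : Hom W (Y ⊗ Z)) R :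
  (X ◁ lift12 f R) ∘ lift22 (braid W X) R =
  lift22 (braid Y X) (Z ⊗ R) ∘ ((Y ◁ lift22 (braid Z X) R) ∘ lift12 f (X ⊗ R)).
Proof.
transitivity ((X ◁ assoc) ∘ assoc ∘ (((X ◁ f) ∘ braid W X) ▷ R) ∘ assoc').
  by rewrite ?lift22E ?lift12E; strict.
rewrite -braid_nat braid_tensl ?lift22E ?lift12E; strict.
Qed.

Lemma braid_whr_r X Y W (f : Hom Y W) R :
  lift22 (braid X W) R ∘ (X ◁ (f ▷ R)) = (f ▷ (X ⊗ R)) ∘ lift22 (braid X Y) R.
Proof.
transitivity (assoc ∘ ((braid X W ∘ (X ◁ f)) ▷ R) ∘ assoc').
  by rewrite ?lift22E; strict.
rewrite braid_nat ?lift22E; strict.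
Qed.

Lemma braid_whr_l X Y W (f : Hom Y W) R :
  lift22 (braid W X) R ∘ (f ▷ (X ⊗ R)) = (X ◁ (f ▷ R)) ∘ lift22 (braid Y X) R.
Proof.
transitivity (assoc ∘ ((braid W X ∘ (f ▷ X)) ▷ R) ∘ assoc').
  by rewrite ?lift22E; strict.
rewrite braid_nat ?lift22E; strict.
Qed.

(* The hexagon makes the braiding with the unit idempotent. *)
Lemma braid_unit_r X : braid X unit_ob = lunit' ∘ runit :> Hom (X ⊗ unit_ob) _.
Proof.
have E : braid X unit_ob ∘ (X ◁ lunit) = (lunit ▷ X) ∘ braid X (unit_ob ⊗ unit_ob).
  by rewrite braid_nat.
rewrite braid_tensr in E.
have [d [dc cd]] := braid_iso X unit_ob.
pose b := lunit ∘ braid X unit_ob ∘ runit'.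
have bb : b ∘ b = b.
  transitivity (lunit ∘ ((lunit ▷ X) ∘
    (assoc' ∘ (unit_ob ◁ braid X unit_ob) ∘ assoc ∘ (braid X unit_ob ▷ unit_ob) ∘ assoc'))
    ∘ assoc ∘ runit' ∘ runit').
    by rewrite /b; strict.
  by rewrite -E /b; strict.
(* An idempotent with a right inverse is the identity. *)
have b1 : b = idm X.
  have bd : b ∘ (runit ∘ d ∘ lunit') = idm X.
    transitivity (lunit ∘ (braid X unit_ob ∘ d) ∘ lunit'); first by rewrite /b; strict.
    by rewrite cd; strict.
  by rewrite -bd {2}(eq_sym bb) -compA bd compf1.
transitivity (lunit' ∘ b ∘ runit); first by rewrite /b; strict.
by rewrite b1; strict.
Qed.

Lemma braid_unit_l X : braid unit_ob X = runit' ∘ lunit :> Hom (unit_ob ⊗ X) _.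
Proof.
have E : braid unit_ob X ∘ (lunit ▷ X) = (X ◁ lunit) ∘ braid (unit_ob ⊗ unit_ob) X.
  by rewrite braid_nat.
rewrite braid_tensl in E.
have [d [dc cd]] := braid_iso unit_ob X.
pose b := runit ∘ braid unit_ob X ∘ lunit'.
have bb : b ∘ b = b.
  transitivity (runit ∘ ((X ◁ lunit) ∘
    (assoc ∘ (braid unit_ob X ▷ unit_ob) ∘ assoc' ∘ (unit_ob ◁ braid unit_ob X) ∘ assoc))
    ∘ assoc' ∘ lunit' ∘ lunit').
    by rewrite /b; strict.
  by rewrite -E /b; strict.
have b1 : b = idm X.
  have bd : b ∘ (lunit ∘ d ∘ runit') = idm X.
    transitivity (runit ∘ (braid unit_ob X ∘ d) ∘ runit'); first by rewrite /b; strict.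
    by rewrite cd; strict.
  by rewrite -bd {2}(eq_sym bb) -compA bd compf1.
transitivity (runit' ∘ b ∘ lunit); first by rewrite /b; strict.
by rewrite b1; strict.
Qed.

Lemma braid_lift01_l X W (f : Hom unit_ob W) R :
  lift22 (braid W X) R ∘ lift01 f (X ⊗ R) = X ◁ lift01 f R.
Proof.
transitivity (assoc ∘ ((braid W X ∘ (f ▷ X)) ▷ R) ∘ assoc' ∘ lunit').
  by rewrite ?lift22E ?lift01E; strict.
rewrite braid_nat braid_unit_l ?lift01E; strict.
Qed.

(** A strand slides past a pairing, since its crossing with the unit object is a cast; meant for the
    evaluation of a dual. *)
Lemma braid_lift20_r X Y Z (f : Hom (Y ⊗ Z) unit_ob) R :
  (lunit ∘ lift21 f (X ⊗ R)) ∘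
    ((Y ◁ lift22 (braid X Z) R) ∘ lift22 (braid X Y) (Z ⊗ R)) =
  X ◁ (lunit ∘ lift21 f R).
Proof.
rewrite -compA -braid_lift21_r braid_unit_r ?lift22E; strict.
Qed.

Lemma lift_tens_comul X Z Z' (d : Hom X (X ⊗ X)) (g : Hom (X ⊗ X) Z)
    (g' : Hom (X ⊗ X) Z') R :
  lift22 ((g ⊠ g') ∘ tens_comul d d) R =
  (Z ◁ lift21 g' R) ∘ (lift21 g (X ⊗ (X ⊗ R)) ∘
   ((X ◁ lift22 (braid X X) (X ⊗ R)) ∘ (lift12 d (X ⊗ (X ⊗ R)) ∘ (X ◁ lift12 d R)))).
Proof.
rewrite /tens_comul /mid_braid tens_split_l (tens_split_r d d) ?lift22E ?lift21E ?lift12E.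
repeat (progress cast_simp).
rewrite (whr_ob (tensA X X R) g) (whr_ob (tensA X X R) d).
strict.
Qed.

End BraidLifts.

(** * The Hopf algebra axioms for lifts *)

Section HopfLifts.
Context {C : strict_braided_category}.
Variable H : hopf_algebra C.
Implicit Types R : C.

Local Notation μ R := (lift21 (mu H) R).
Local Notation δ R := (lift12 (delta H) R).
Local Notation η R := (lift01 (eta H) R).
Local Notation ε R := (lift10 (eps H) R).
Local Notation λ R := (lam H ▷ R).
Local Notation c R := (lift22 (braid H H) R).

Lemma lift_mu_assoc R : μ R ∘ μ (H ⊗ R) = μ R ∘ (H ◁ μ R).
Proof.
transitivity (((mu H ∘ (mu H ▷ H)) ▷ R) ∘ assoc' ∘ assoc').
  by rewrite ?lift21E; strict.
rewrite (alg_assoc (hopf_algebraP H)) ?lift21E; strict.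
Qed.

Lemma lift_mu_unitl R : μ R ∘ η (H ⊗ R) = idm (H ⊗ R).
Proof.
transitivity ((mu H ∘ (eta H ▷ H) ∘ lunit') ▷ R).
  by rewrite ?lift21E ?lift01E; strict.
rewrite (alg_unitl (hopf_algebraP H)); strict.
Qed.

Lemma lift_mu_unitr R : μ R ∘ (H ◁ η R) = idm (H ⊗ R).
Proof.
transitivity ((mu H ∘ (H ◁ eta H) ∘ runit') ▷ R).
  by rewrite ?lift21E ?lift01E; strict.
rewrite (alg_unitr (hopf_algebraP H)); strict.
Qed.

Lemma lift_delta_coassoc R : δ (H ⊗ R) ∘ δ R = (H ◁ δ R) ∘ δ R.
Proof.
transitivity ((H ◁ assoc) ∘ assoc ∘ (((assoc ∘ (delta H ▷ H) ∘ delta H) ▷ R))).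
  by rewrite ?lift12E; strict.
rewrite (coalg_coassoc (hopf_coalgebraP H)) ?lift12E; strict.
Qed.

Lemma lift_delta_counitl R : ε (H ⊗ R) ∘ δ R = idm (H ⊗ R).
Proof.
transitivity ((lunit ∘ (eps H ▷ H) ∘ delta H) ▷ R).
  by rewrite ?lift12E ?lift10E; strict.
rewrite (coalg_counitl (hopf_coalgebraP H)); strict.
Qed.

Lemma lift_delta_counitr R : (H ◁ ε R) ∘ δ R = idm (H ⊗ R).
Proof.
transitivity ((runit ∘ (H ◁ eps H) ∘ delta H) ▷ R).
  by rewrite ?lift12E ?lift10E; strict.
rewrite (coalg_counitr (hopf_coalgebraP H)); strict.
Qed.

Lemma lift_eps_mu R : ε R ∘ μ R = ε R ∘ ε (H ⊗ R).
Proof.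
transitivity (lunit ∘ ((eps H ∘ mu H) ▷ R) ∘ assoc').
  by rewrite ?lift21E ?lift10E; strict.
rewrite (algm_mul (hopf_eps_morph H)) (tens_split_l (eps H) (eps H)) ?lift10E; strict.
Qed.

Lemma lift_eps_eta R : ε R ∘ η R = idm R.
Proof.
transitivity (lunit ∘ ((eps H ∘ eta H) ▷ R) ∘ lunit').
  by rewrite ?lift01E ?lift10E; strict.
rewrite (algm_unit (hopf_eps_morph H)); strict.
Qed.

Lemma lift_delta_eta R : δ R ∘ η R = (H ◁ η R) ∘ η R.
Proof.
transitivity (assoc ∘ ((delta H ∘ eta H) ▷ R) ∘ lunit').
  by rewrite ?lift01E ?lift12E; strict.
rewrite (algm_unit (hopf_delta_morph H)) /tens_unit (tens_split_l (eta H) (eta H)) ?lift01E.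
repeat (progress cast_simp).
rewrite (whr_ob (tens1o R) (eta H)); strict.
Qed.

Lemma lift_comul_of (g : Hom (H ⊗ H) H) :
  delta H ∘ g = (g ⊠ g) ∘ tens_comul (delta H) (delta H) -> forall R,
  δ R ∘ lift21 g R =
  (H ◁ lift21 g R) ∘ (lift21 g (H ⊗ (H ⊗ R)) ∘
   ((H ◁ c (H ⊗ R)) ∘ (δ (H ⊗ (H ⊗ R)) ∘ (H ◁ δ R)))).
Proof.
move=> E R.
transitivity (lift22 (delta H ∘ g) R).
  by rewrite ?lift12E ?lift21E ?lift22E; strict.
by rewrite E lift_tens_comul.
Qed.

Lemma lift_delta_mu R :
  δ R ∘ μ R =
  (H ◁ μ R) ∘ (μ (H ⊗ (H ⊗ R)) ∘
   ((H ◁ c (H ⊗ R)) ∘ (δ (H ⊗ (H ⊗ R)) ∘ (H ◁ δ R)))).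
Proof.
apply: lift_comul_of.
by rewrite (algm_mul (hopf_delta_morph H)) /tens_mul /tens_comul !compA.
Qed.

Lemma lift_antipode_r R : μ R ∘ ((H ◁ λ R) ∘ δ R) = η R ∘ ε R.
Proof.
transitivity ((mu H ∘ (H ◁ lam H) ∘ delta H) ▷ R).
  by rewrite ?lift12E ?lift21E; strict.
rewrite hopf_antipode_r ?lift01E ?lift10E; strict.
Qed.

Lemma lift_antipode_l R : μ R ∘ (λ (H ⊗ R) ∘ δ R) = η R ∘ ε R.
Proof.
transitivity ((mu H ∘ (lam H ▷ H) ∘ delta H) ▷ R).
  by rewrite ?lift12E ?lift21E; strict.
rewrite hopf_antipode_l ?lift01E ?lift10E; strict.
Qed.

End HopfLifts.

Section WhiskeredEquations.
Context {C : strict_monoidal_category}.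
Implicit Types P W X Y Z U V : C.

Lemma whl_eq1 {P X Y} (a r : Hom X Y) : a = r -> P ◁ a = P ◁ r.
Proof. by move=> ->. Qed.

Lemma whl_eq2 {P X Y Z} (a : Hom Y Z) (b : Hom X Y) r :
  a ∘ b = r -> (P ◁ a) ∘ (P ◁ b) = P ◁ r.
Proof. by move=> <-; rewrite whl_comp. Qed.

Lemma whl_eq3 {P X Y Z U} (a : Hom Y Z) (b : Hom X Y) (c : Hom U X) r :
  a ∘ (b ∘ c) = r -> (P ◁ a) ∘ ((P ◁ b) ∘ (P ◁ c)) = P ◁ r.
Proof. by move=> <-; rewrite !whl_comp. Qed.

End WhiskeredEquations.

Ltac nf := rewrite ?(whl_comp, comp1f, compf1, tensm_id) -?compA.

(* [rw] rewrites inside right-nested composites, [rw1] and [rw2] under one and two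
   whiskerings on the left. *)
Tactic Notation "rw" uconstr(E) :=
  first [ rewrite E | rewrite (comp_eq2 E) | rewrite (comp_eq3 E)
        | rewrite (comp_eq4 E) | rewrite (comp_eq5 E) ]; nf.
Tactic Notation "rw1" uconstr(E) :=
  first [ rw (whl_eq1 E) | rw (whl_eq2 E) | rw (whl_eq3 E) ].
Tactic Notation "rw2" uconstr(E) :=
  first [ rw1 (whl_eq1 E) | rw1 (whl_eq2 E) | rw1 (whl_eq3 E) ].

(** * Consequences of the antipode and of cocommutativity *)

Section HopfCancellation.
Context {C : strict_braided_category}.
Variable H : hopf_algebra C.
Implicit Types R : C.

Local Notation μ R := (lift21 (mu H) R).
Local Notation δ R := (lift12 (delta H) R).
Local Notation η R := (lift01 (eta H) R).
Local Notation ε R := (lift10 (eps H) R).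
Local Notation λ R := (lam H ▷ R).
Local Notation c R := (lift22 (braid H H) R).

(* [y |-> x_1 u(x_2, y)] determines [u], by multiplying with [λ(x_1)]. *)
Lemma convolution_cancel Y Z (u v : Hom (H ⊗ Y) (H ⊗ Z)) :
  μ Z ∘ ((H ◁ u) ∘ δ Y) = μ Z ∘ ((H ◁ v) ∘ δ Y) -> u = v.
Proof.
have key w : μ Z ∘ (λ (H ⊗ Z) ∘ ((H ◁ (μ Z ∘ ((H ◁ w) ∘ δ Y))) ∘ δ Y)) = w.
  nf.
  rw (eq_sym (lift_delta_coassoc _ _)).
  rw (eq_sym (whr_nat _ _)).
  rw (eq_sym (lift_mu_assoc _ _)).
  rw (eq_sym (whr_nat _ _)).
  rw (eq_sym (lift21_nat _ _)).
  rw (lift_antipode_l _ _).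
  rw (lift_delta_counitl _ _).
  rw (lift01_nat _ _).
  by rw (lift_mu_unitl _ _).
by move=> E; rewrite -(key u) -(key v) E.
Qed.

Section Cocommutative.
Hypothesis cocH : cocommutative H.

Lemma lift_cocommutative R : c R ∘ δ R = δ R.
Proof.
transitivity (lift12 (braid H H ∘ delta H) R); last by rewrite cocH.
by rewrite ?lift12E ?lift22E; strict.
Qed.

(** Applying [d] to [δ ∘ μ] changes nothing, because [δ] is cocommutative. Pushed through both
    products, [d] becomes four crossings: one cancels the braiding, two are absorbed by the
    coproducts, and one remains. *)
Lemma lift_comul_mul_inverse (d : Hom (H ⊗ H) (H ⊗ H)) R :
  is_inverse (braid H H) d ->
  δ R ∘ μ R =
  (H ◁ μ R) ∘ (μ (H ⊗ (H ⊗ R)) ∘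
   ((H ◁ lift22 d (H ⊗ R)) ∘ (δ (H ⊗ (H ⊗ R)) ∘ (H ◁ δ R)))).
Proof.
move=> [dc cd].
have dcR S : lift22 d S ∘ c S = idm _.
  transitivity (assoc ∘ ((d ∘ braid H H) ▷ S) ∘ assoc'); first by rewrite !lift22E; strict.
  by rewrite dc; strict.
have cdR S : c S ∘ lift22 d S = idm _.
  transitivity (assoc ∘ ((braid H H ∘ d) ▷ S) ∘ assoc'); first by rewrite !lift22E; strict.
  by rewrite cd; strict.
have dd S : lift22 d S ∘ δ S = δ S.
  by rewrite -{1}lift_cocommutative compA dcR comp1f.
have dr S : lift22 d S ∘ (μ (H ⊗ S)) = (H ◁ μ S) ∘ (lift22 d (H ⊗ S) ∘ (H ◁ lift22 d S)).
  symmetry; rewrite -[LHS]comp1f -dcR; nf.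
  rw (braid_lift21_r _ _ _).
  rw (cdR _).
  by rw1 (cdR _).
have dl S : lift22 d S ∘ (H ◁ μ S) = μ (H ⊗ S) ∘ ((H ◁ lift22 d S) ∘ lift22 d (H ⊗ S)).
  symmetry; rewrite -[LHS]comp1f -dcR; nf.
  rw (braid_lift21_l _ _ _).
  rw1 (cdR _).
  by rw (cdR _).
transitivity (lift22 d R ∘ (δ R ∘ μ R)); first by rewrite compA dd.
rewrite lift_delta_mu; nf.
rw (dl _).
rw (dr _).
rw1 (dcR _).
rw1 (dr _).
rw (lift22_nat _ _).
rw (lift12_nat _ _).
rw1 (dd _).
rw (dd _).
by rw (eq_sym (lift21_nat _ _)).
Qed.

(* Schauenburg: in a Hopf algebra the braiding can be recovered from
   [delta ∘ mu], and a cocommutative [delta] is blind to the difference between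
   the braiding and its inverse. *)
Lemma braid_involutive : braid H H ∘ braid H H = idm (H ⊗ H).
Proof.
have [d dI] := braid_iso H H.
suff Ed : braid H H = d by case: dI => [_]; rewrite -Ed.
(* Both expressions of [δ ∘ μ] have the form x_1 u(x_2, y), where only u depends on the crossing;
   x_1 is cancelled. *)
have E R : (H ◁ μ R) ∘ (lift22 (braid H H) (H ⊗ R) ∘ (H ◁ δ R)) =
           (H ◁ μ R) ∘ (lift22 d (H ⊗ R) ∘ (H ◁ δ R)).
  have M b : (H ◁ μ R) ∘ (μ (H ⊗ (H ⊗ R)) ∘ ((H ◁ lift22 b (H ⊗ R)) ∘
      (δ (H ⊗ (H ⊗ R)) ∘ (H ◁ δ R)))) =
    μ (H ⊗ R) ∘ ((H ◁ ((H ◁ μ R) ∘ (lift22 b (H ⊗ R) ∘ (H ◁ δ R)))) ∘ δ (H ⊗ R)).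
    nf.
    rw (eq_sym (lift21_nat _ _)).
    by rw (eq_sym (lift12_nat _ _)).
  by apply: convolution_cancel; rewrite -!M -(lift_comul_mul_inverse R dI) lift_delta_mu.
(* On the other side y_2 λ(y_3) collapses, and only the crossing [b] remains. *)
have key b R : (H ◁ μ R) ∘ ((H ◁ (H ◁ λ R)) ∘
    (((H ◁ μ (H ⊗ R)) ∘ (lift22 b (H ⊗ (H ⊗ R)) ∘ (H ◁ δ (H ⊗ R)))) ∘ (H ◁ δ R))) =
    lift22 b R.
  nf.
  rw1 (lift_delta_coassoc _ _).
  rw1 (lift21_nat _ _).
  rw1 (lift_mu_assoc _ _).
  rw (eq_sym (lift22_nat _ _)).
  rw2 (lift_antipode_r _ _).
  rw (lift22_nat _ _).
  rw1 (lift_delta_counitr _ _).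
  by rw1 (lift_mu_unitr _ _).
by apply: lift22_inj => R; rewrite -[LHS]key -[RHS]key E.
Qed.

Lemma lift_braid_involutive R : c R ∘ c R = idm (H ⊗ (H ⊗ R)).
Proof.
transitivity (assoc ∘ ((braid H H ∘ braid H H) ▷ R) ∘ assoc').
  by rewrite !lift22E; strict.
by rewrite braid_involutive; strict.
Qed.

(** Both sides are right inverses of [δ] for the convolution with values in the tensor square. Left
    multiplication by δ(x_1) is split into [w], which acts on the second leg, and a multiplication
    on the first leg; each of them can be cancelled. *)
Lemma lift_delta_lam R : δ R ∘ λ R = λ (H ⊗ R) ∘ ((H ◁ λ R) ∘ δ R).
Proof.
pose w (u : Hom (H ⊗ R) (H ⊗ (H ⊗ R))) :=
  (H ◁ μ R) ∘ (c (H ⊗ R) ∘ ((H ◁ u) ∘ δ R)).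
have w_cancel u : (H ◁ μ R) ∘ (c (H ⊗ R) ∘ (λ (H ⊗ (H ⊗ R)) ∘ ((H ◁ w u) ∘ δ R))) = u.
  rewrite /w; nf.
  rw (eq_sym (lift_delta_coassoc _ _)).
  rw (eq_sym (whr_nat _ _)).
  rw (eq_sym (whr_nat _ _)).
  rw (eq_sym (whr_nat _ _)).
  rw (eq_sym (lift22_nat _ _)).
  rw1 (eq_sym (lift_mu_assoc _ _)).
  rw (eq_sym (braid_lift21_l _ _ _)).
  rw (eq_sym (lift21_nat _ _)).
  rw (lift_antipode_l _ _).
  rw (lift_delta_counitl _ _).
  rw (lift01_nat _ _).
  rw (braid_lift01_l _ _ _).
  by rw1 (lift_mu_unitl _ _).
rewrite -[LHS]w_cancel -[RHS]w_cancel; congr (_ ∘ (_ ∘ (_ ∘ ((H ◁ _) ∘ _)))).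
apply: convolution_cancel; rewrite /w; nf.
transitivity ((H ◁ η R) ∘ (η R ∘ ε R)).
  rw (eq_sym (lift_delta_coassoc _ _)).
  rw (eq_sym (lift21_nat _ _)).
  rw (lift12_nat _ _).
  rw (lift12_nat _ _).
  rw (eq_sym (lift_delta_mu _ _)).
  rw (lift_antipode_r _ _).
  by rw (lift_delta_eta _ _).
(* The product is now x_1 λ(x_3) ⊗ x_2 λ(x_4); cocommutativity undoes the crossing of x_2 and
   x_3. *)
rw1 (braid_whr_r _ _ _).
rw1 (eq_sym (lift22_nat _ _)).
rw1 (eq_sym (lift_delta_coassoc _ _)).
rw1 (lift_cocommutative _).
rw1 (lift_delta_coassoc _ _).
rw1 (whr_nat _ _).
rw2 (lift_antipode_r _ _).
rw1 (lift_delta_counitr _ _).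
rw1 (eq_sym (whr_nat _ _)).
rw (eq_sym (lift21_nat _ _)).
by rw (lift_antipode_r _ _).
Qed.

Lemma lift_eps_lam R : ε R ∘ λ R = ε R.
Proof.
transitivity (ε R ∘ (ε (H ⊗ R) ∘ ((H ◁ λ R) ∘ δ R))).
  rw (eq_sym (lift10_nat _ _)).
  by rw (lift_delta_counitl _ _).
rw (eq_sym (lift_eps_mu _ _)).
rw (lift_antipode_r _ _).
by rw (lift_eps_eta _ _).
Qed.

End Cocommutative.
End HopfCancellation.

(** * Operations on [H] and convolution of its endomorphisms *)

Section Operations.
Context {C : strict_braided_category}.
Variable H : hopf_algebra C.
Implicit Types (R : C) (φ ψ χ : Hom (H ⊗ H) H) (f g h : Hom H H).

Local Notation μ R := (lift21 (mu H) R).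
Local Notation δ R := (lift12 (delta H) R).
Local Notation η R := (lift01 (eta H) R).
Local Notation ε R := (lift10 (eps H) R).
Local Notation λ R := (lam H ▷ R).
Local Notation c R := (lift22 (braid H H) R).

Definition coalg_endo f : Prop :=
  is_coalgebra_morphism (eps H) (delta H) (eps H) (delta H) f.

(* [x |-> φ(f(x_1), g(x_2))] *)
Definition conv φ f g : Hom H H := φ ∘ (f ⊠ g) ∘ delta H.

(* [(x, y) |-> φ(x_1, ψ(x_2, y))]; in particular [sub_mul φ] is
   [op_mul (mu H) φ]. *)
Definition op_mul φ ψ : Hom (H ⊗ H) H := φ ∘ (H ◁ ψ) ∘ assoc ∘ (delta H ▷ H).

Definition op_one : Hom (H ⊗ H) H := lunit ∘ (eps H ▷ H).

Definition op_at φ f : Hom (H ⊗ H) H := φ ∘ (f ▷ H).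

Definition conv_one : Hom H H := eta H ∘ eps H.

Lemma lift_conv φ f g R :
  conv φ f g ▷ R = lift21 φ R ∘ ((f ▷ (H ⊗ R)) ∘ ((H ◁ (g ▷ R)) ∘ δ R)).
Proof. by rewrite /conv (tens_split_r f g) lift21E lift12E; strict. Qed.

Lemma lift_op_mul φ ψ R :
  lift21 (op_mul φ ψ) R = lift21 φ R ∘ ((H ◁ lift21 ψ R) ∘ δ (H ⊗ R)).
Proof. by rewrite /op_mul !lift21E lift12E; strict. Qed.

Lemma lift_op_one R : lift21 op_one R = ε (H ⊗ R).
Proof. by rewrite /op_one lift21E lift10E; strict. Qed.

Lemma lift_op_at φ f R : lift21 (op_at φ f) R = lift21 φ R ∘ (f ▷ (H ⊗ R)).
Proof. by rewrite /op_at !lift21E; strict. Qed.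

Lemma lift_conv_one R : conv_one ▷ R = η R ∘ ε R.
Proof. by rewrite /conv_one lift01E lift10E; strict. Qed.

Lemma lift_coalg_comul f R :
  coalg_endo f -> δ R ∘ (f ▷ R) = (f ▷ (H ⊗ R)) ∘ ((H ◁ (f ▷ R)) ∘ δ R).
Proof.
move=> [_ fd].
transitivity (lift12 (delta H ∘ f) R); first by rewrite !lift12E; strict.
by rewrite fd (tens_split_r f f) !lift12E; strict.
Qed.

Lemma lift_coalg_counit f R : coalg_endo f -> ε R ∘ (f ▷ R) = ε R.
Proof.
move=> [fe _].
transitivity (lift10 (eps H ∘ f) R); first by rewrite !lift10E; strict.
by rewrite fe.
Qed.

Lemma coalg_endo_of_lift f :
  (forall R, δ R ∘ (f ▷ R) = (f ▷ (H ⊗ R)) ∘ ((H ◁ (f ▷ R)) ∘ δ R)) ->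
  (forall R, ε R ∘ (f ▷ R) = ε R) -> coalg_endo f.
Proof.
move=> fd fe; split.
  apply: whr_inj; apply: (idto_cancel_l (e := tens1o unit_ob)).
  by have := fe unit_ob; rewrite !lift10E /lunit whr_comp compA.
apply: lift12_inj => R.
transitivity (δ R ∘ (f ▷ R)); first by rewrite !lift12E; strict.
by rewrite fd (tens_split_r f f) !lift12E; strict.
Qed.

Lemma lift_tensor_coalg φ R :
  is_tensor_coalgebra_morphism φ ->
  δ R ∘ lift21 φ R =
  (H ◁ lift21 φ R) ∘ (lift21 φ (H ⊗ (H ⊗ R)) ∘
   ((H ◁ c (H ⊗ R)) ∘ (δ (H ⊗ (H ⊗ R)) ∘ (H ◁ δ R)))).
Proof. by move=> [_ E]; apply: lift_comul_of. Qed.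

Lemma lift_tensor_counit φ R :
  is_tensor_coalgebra_morphism φ -> ε R ∘ lift21 φ R = ε R ∘ ε (H ⊗ R).
Proof.
move=> [E _].
transitivity (lunit ∘ ((eps H ∘ φ) ▷ R) ∘ assoc').
  by rewrite lift10E lift21E; strict.
by rewrite E /tens_counit (tens_split_l (eps H) (eps H)) !lift10E; strict.
Qed.

Lemma lift_op_assoc φ R :
  φ ∘ (H ◁ φ) = φ ∘ (sub_mul φ ▷ H) ∘ assoc' ->
  lift21 φ R ∘ (H ◁ lift21 φ R) = lift21 φ R ∘ lift21 (op_mul (mu H) φ) (H ⊗ R).
Proof.
move=> E.
transitivity (((φ ∘ (H ◁ φ)) ▷ R) ∘ assoc' ∘ (H ◁ assoc')).
  by rewrite !lift21E; strict.
by rewrite E /op_mul -/(sub_mul φ) !lift21E; strict.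
Qed.

Lemma lift_distributes φ R :
  distributes_over_mul φ ->
  lift21 φ R ∘ (H ◁ μ R) =
  μ R ∘ ((H ◁ lift21 φ R) ∘ (lift21 φ (H ⊗ (H ⊗ R)) ∘
    ((H ◁ c (H ⊗ R)) ∘ δ (H ⊗ (H ⊗ R))))).
Proof.
move=> E.
transitivity (((φ ∘ (H ◁ mu H)) ▷ R) ∘ assoc' ∘ (H ◁ assoc')).
  by rewrite !lift21E; strict.
rewrite E (tens_split_l φ φ) /mid_braid !lift21E lift22E lift12E.
repeat (progress cast_simp).
rewrite (whr_ob (tensA H H R) φ) (whr_ob (tensA H H R) (delta H)).
strict.
Qed.

End Operations.

(** * The monoid of operations and its action on coalgebra endomorphisms *)

Section Calculus.
Context {C : strict_braided_category}.
Variable H : hopf_algebra C.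
Implicit Types (R : C) (φ ψ χ : Hom (H ⊗ H) H) (f g h : Hom H H).

Local Notation μ R := (lift21 (mu H) R).
Local Notation δ R := (lift12 (delta H) R).
Local Notation η R := (lift01 (eta H) R).
Local Notation ε R := (lift10 (eps H) R).
Local Notation λ R := (lam H ▷ R).
Local Notation c R := (lift22 (braid H H) R).
Local Notation op_one := (op_one H).
Local Notation conv_one := (conv_one H).
Local Notation "f · g" := (conv (mu H) f g) (at level 40, left associativity).

Lemma whr_ext f g : (forall R, f ▷ R = g ▷ R) -> f = g.
Proof. by move=> /(_ unit_ob) /whr_inj. Qed.

Lemma conv_mulA f g h : f · (g · h) = f · g · h.
Proof.
apply: whr_ext => R; rewrite !lift_conv; nf.
rw (eq_sym (lift_delta_coassoc _ _)).
rw (eq_sym (lift12_nat _ _)).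
rw (eq_sym (whr_nat _ _)).
by rw (eq_sym (lift_mu_assoc _ _)).
Qed.

Lemma op_mulA φ ψ χ : op_mul φ (op_mul ψ χ) = op_mul (op_mul φ ψ) χ.
Proof.
apply: lift21_inj => R; rewrite !lift_op_mul; nf.
rw (eq_sym (lift_delta_coassoc _ _)).
by rw (lift12_nat _ _).
Qed.

Lemma op_mul1 φ : op_mul φ op_one = φ.
Proof.
apply: lift21_inj => R; rewrite lift_op_mul lift_op_one.
by rw (lift_delta_counitr _ _).
Qed.

Lemma op_1mul φ : op_mul op_one φ = φ.
Proof.
apply: lift21_inj => R; rewrite lift_op_mul lift_op_one; nf.
rw (eq_sym (lift10_nat _ _)).
by rw (lift_delta_counitl _ _).
Qed.

Lemma op_at_id φ : op_at φ (idm H) = φ.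
Proof. by rewrite /op_at tensm_id compf1. Qed.

Lemma conv_1mul f : conv_one · f = f.
Proof.
apply: whr_ext => R; rewrite lift_conv lift_conv_one; nf.
rw (eq_sym (lift10_nat _ _)).
rw (lift_delta_counitl _ _).
by rw (lift_mu_unitl _ _).
Qed.

Lemma conv_mul1 f : f · conv_one = f.
Proof.
apply: whr_ext => R; rewrite lift_conv lift_conv_one; nf.
rw (lift_delta_counitr _ _).
rw (eq_sym (whr_nat _ _)).
by rw (lift_mu_unitr _ _).
Qed.

Lemma conv_one_comp f : coalg_endo f -> conv_one ∘ f = conv_one.
Proof. by move=> [fe _]; rewrite /conv_one -compA fe. Qed.

Lemma conv_comp φ f g h : coalg_endo h -> conv φ f g ∘ h = conv φ (f ∘ h) (g ∘ h).
Proof.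
by move=> [_ hd]; rewrite /conv -compA hd -!compA (compA (f ⊠ g)) -tensm_comp.
Qed.

Lemma conv_lam f : coalg_endo f -> f · (lam H ∘ f) = conv_one.
Proof.
move=> fG; rewrite -{1}(comp1f f) -conv_comp // -(conv_one_comp fG).
by rewrite /conv hopf_antipode_r.
Qed.

Lemma lam_conv f : coalg_endo f -> (lam H ∘ f) · f = conv_one.
Proof.
move=> fG; rewrite -{2}(comp1f f) -conv_comp // -(conv_one_comp fG).
by rewrite /conv hopf_antipode_l.
Qed.

Lemma op_at_mul φ ψ f : coalg_endo f ->
  op_at (op_mul φ ψ) f = op_mul (op_at φ f) (op_at ψ f).
Proof.
move=> fG; apply: lift21_inj => R.
rewrite !(lift_op_mul, lift_op_at); nf.
rw (lift_coalg_comul _ fG).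
by rw (whr_nat _ _).
Qed.

Lemma op_at_one f : coalg_endo f -> op_at op_one f = op_one.
Proof.
move=> fG; apply: lift21_inj => R; rewrite lift_op_at !lift_op_one.
exact: lift_coalg_counit.
Qed.

Lemma conv_op_mul φ ψ f g : coalg_endo f ->
  conv φ f (conv ψ f g) = conv (op_mul φ ψ) f g.
Proof.
move=> fG; apply: whr_ext => R; rewrite !lift_conv !lift_op_mul; nf.
rw (eq_sym (lift_delta_coassoc _ _)).
rw (lift_coalg_comul _ fG).
rw (whr_nat _ _).
by rw (eq_sym (lift12_nat _ _)).
Qed.

Lemma conv_op_one f g : coalg_endo f -> conv op_one f g = g.
Proof.
move=> fG; apply: whr_ext => R; rewrite !lift_conv lift_op_one.
rw (lift_coalg_counit _ fG).
rw (eq_sym (lift10_nat _ _)).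
by rw (lift_delta_counitl _ _).
Qed.

(** The associativity condition evaluated at [f] and [g]: the operators compose as an action of the
    law f * g = f · φ(f, g). *)
Lemma conv_mul_op φ f g :
  φ ∘ (H ◁ φ) = φ ∘ (sub_mul φ ▷ H) ∘ assoc' -> coalg_endo f ->
  op_mul (op_at φ f) (op_at φ g) = op_at φ (f · conv φ f g).
Proof.
move=> E fG; apply: lift21_inj => R.
rewrite !(lift_op_mul, lift_op_at, lift_conv).
nf.
rw (eq_sym (whr_nat _ _)).
rw (lift_op_assoc _ E).
rewrite lift_op_mul; nf.
rw (lift_coalg_comul _ fG).
rw (whr_nat _ _).
rw (eq_sym (lift12_nat _ _)).
by rw (lift_delta_coassoc _ _).
Qed.

Section Cocommutative.
Hypothesis cocH : cocommutative H.

Lemma conv_distributes φ f g h :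
  distributes_over_mul φ -> coalg_endo f ->
  conv φ f (g · h) = conv φ f g · conv φ f h.
Proof.
move=> E fG; apply: whr_ext => R; rewrite !lift_conv.
nf.
rw (eq_sym (whr_nat _ _)).
rw (lift_distributes _ E).
rw (lift_coalg_comul _ fG).
do 2 rw (eq_sym (lift12_nat _ _)).
rw (whr_nat _ _).
rw1 (braid_whr_l _ _ _).
rw1 (braid_whr_r _ _ _).
rw1 (eq_sym (lift22_nat _ _)).
rw (eq_sym (lift_delta_coassoc _ _)).
rw (lift_delta_coassoc H (H ⊗ R)).
(* The two sides differ in the order of the middle copies x_2 and x_3 of x, which cocommutativity
   exchanges. *)
rw1 (lift_cocommutative cocH _).
rw (eq_sym (lift_delta_coassoc H (H ⊗ R))).
rw (lift_delta_coassoc H R).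
symmetry.
do 3 rw (eq_sym (lift12_nat _ _)).
rw1 (eq_sym (whr_nat _ _)).
rw (eq_sym (whr_nat _ _)).
rw (eq_sym (lift21_nat _ _)).
by rw1 (whr_nat _ _).
Qed.

Lemma coalg_endo_conv φ f g : is_tensor_coalgebra_morphism φ ->
  coalg_endo f -> coalg_endo g -> coalg_endo (conv φ f g).
Proof.
move=> E fG gG; apply: coalg_endo_of_lift => R; rewrite !lift_conv; nf.
  rw (lift_tensor_coalg _ E).
  rw (whr_nat _ _).
  rw1 (lift_coalg_comul _ gG).
  rw (lift_coalg_comul _ fG).
  do 2 rw (eq_sym (lift12_nat _ _)).
  rw (whr_nat _ _).
  rw1 (braid_whr_l _ _ _).
  rw1 (braid_whr_r _ _ _).
  rw1 (eq_sym (lift22_nat _ _)).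
  rw (eq_sym (lift_delta_coassoc _ _)).
  rw (lift_delta_coassoc H (H ⊗ R)).
  rw1 (lift_cocommutative cocH _).
  rw (eq_sym (lift_delta_coassoc H (H ⊗ R))).
  rw (lift_delta_coassoc H R).
  symmetry.
  do 3 rw (eq_sym (lift12_nat _ _)).
  rw1 (eq_sym (whr_nat _ _)).
  rw (eq_sym (whr_nat _ _)).
  rw (eq_sym (lift21_nat _ _)).
  by rw1 (whr_nat _ _).
rw (lift_tensor_counit _ E).
rw (lift_coalg_counit _ fG).
rw (eq_sym (lift10_nat _ _)).
rw (lift_delta_counitl _ _).
exact: lift_coalg_counit.
Qed.

Lemma coalg_endo_lam : coalg_endo (lam H).
Proof.
by apply: coalg_endo_of_lift => R; [exact: lift_delta_lam | exact: lift_eps_lam].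
Qed.

End Cocommutative.

Lemma coalg_endo_id : coalg_endo (idm H).
Proof. by split; rewrite ?tensm_id ?comp1f compf1. Qed.

Lemma coalg_endo_one : coalg_endo conv_one.
Proof.
apply: coalg_endo_of_lift => R; rewrite !lift_conv_one; nf; last first.
  by rw (lift_eps_eta _ _).
rw (lift_delta_eta _ _).
rw (eq_sym (lift10_nat _ _)).
rw (lift01_nat _ _).
by rw (lift_delta_counitr _ _).
Qed.

Lemma conv_op_at φ f g : conv φ f g = conv (op_at φ f) (idm H) g.
Proof. by rewrite /conv /op_at (tens_split_r f g) !compA. Qed.

Lemma conv_act φ f g h :
  φ ∘ (H ◁ φ) = φ ∘ (sub_mul φ ▷ H) ∘ assoc' -> coalg_endo f ->
  conv φ f (conv φ g h) = conv φ (f · conv φ f g) h.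
Proof.
move=> E fG; rewrite (conv_op_at φ f) (conv_op_at φ g) (conv_op_at φ (_ · _)).
by rewrite (conv_op_mul _ _ _ coalg_endo_id) conv_mul_op.
Qed.

Lemma op_mul_inverse_unique φ ψ ψ' :
  op_mul ψ φ = op_one -> op_mul φ ψ' = op_one -> ψ = ψ'.
Proof. by move=> E E'; rewrite -(op_mul1 ψ) -E' op_mulA E op_1mul. Qed.

Lemma comul_of_lift φ :
  (forall R, δ R ∘ lift21 φ R =
    (H ◁ lift21 φ R) ∘ (lift21 φ (H ⊗ (H ⊗ R)) ∘
     ((H ◁ c (H ⊗ R)) ∘ (δ (H ⊗ (H ⊗ R)) ∘ (H ◁ δ R))))) ->
  delta H ∘ φ = (φ ⊠ φ) ∘ tens_comul (delta H) (delta H).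
Proof.
move=> E; apply: lift22_inj => R; rewrite lift_tens_comul -E.
by rewrite lift12E lift21E lift22E; strict.
Qed.

Lemma tensor_counit_of_lift φ :
  (forall R, ε R ∘ lift21 φ R = ε R ∘ ε (H ⊗ R)) ->
  eps H ∘ φ = tens_counit (eps H) (eps H).
Proof.
move=> E; apply: lift21_inj => R.
apply: (idto_cancel_l (e := tens1o R)).
transitivity (ε R ∘ lift21 φ R).
  by rewrite lift10E !lift21E; strict.
rewrite E /tens_counit (tens_split_l (eps H) (eps H)) !lift10E lift21E; strict.
Qed.

(** What (star) leaves open is counitality, and ε(ψ(x, y)) = ε(φ(x_1, ψ(x_2, y))) = ε(x) ε(y). *)
Lemma op_inverse_tensor_coalg φ ψ :
  is_tensor_coalgebra_morphism φ -> op_mul φ ψ = op_one ->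
  delta H ∘ ψ = (ψ ⊠ ψ) ∘ tens_comul (delta H) (delta H) ->
  is_tensor_coalgebra_morphism ψ.
Proof.
move=> φG E Ed; split=> //; apply: tensor_counit_of_lift => R.
rewrite -lift_op_one -E lift_op_mul.
rw (lift_tensor_counit _ φG).
rw (eq_sym (lift10_nat _ _)).
by rw (lift_delta_counitl _ _).
Qed.

Lemma op_at_comul φ f : is_tensor_coalgebra_morphism φ -> coalg_endo f ->
  delta H ∘ op_at φ f = (op_at φ f ⊠ op_at φ f) ∘ tens_comul (delta H) (delta H).
Proof.
move=> φG fG; apply: comul_of_lift => R; rewrite !lift_op_at; nf.
rw (lift_tensor_coalg _ φG).
rw (whr_nat _ _).
rw (lift_coalg_comul _ fG).
rw (whr_nat _ _).
rw1 (braid_whr_l _ _ _).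
rw (lift21_nat _ (f ▷ _)).
by rw (whr_nat _ _).
Qed.

Lemma op_at_conv_one φ :
  op_at φ conv_one = φ ∘ (eta H ▷ H) ∘ lunit' ∘ op_one.
Proof. by rewrite /op_at /conv_one /op_one; strict. Qed.

Lemma op_at_unit φ :
  op_at φ conv_one = op_one -> φ ∘ (eta H ▷ H) ∘ lunit' = idm H.
Proof.
move=> E.
have oI : op_one ∘ ((eta H ▷ H) ∘ lunit') = idm H.
  transitivity (lunit ∘ ((eps H ∘ eta H) ▷ H) ∘ lunit').
    by rewrite /op_one; strict.
  by rewrite (algm_unit (hopf_eps_morph H)); strict.
transitivity (φ ∘ (eta H ▷ H) ∘ lunit' ∘ (op_one ∘ ((eta H ▷ H) ∘ lunit'))).
  by rewrite oI compf1.
by rewrite compA -op_at_conv_one E oI.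
Qed.

(** * Group arguments for coalgebra endomorphisms *)

Section GroupLaws.
Hypothesis cocH : cocommutative H.

Lemma conv_idempotent f : coalg_endo f -> f · f = f -> f = conv_one.
Proof. by move=> fG ff; rewrite -(lam_conv fG) -{3}ff conv_mulA lam_conv // conv_1mul. Qed.

(** For convolution, [lam H] has the left inverse [idm H] and the right inverse [lam H ∘ lam H]. *)
Lemma lam_involutive : lam H ∘ lam H = idm H.
Proof.
have lG := coalg_endo_lam cocH.
have lid : lam H · idm H = conv_one.
  by rewrite -{1}(compf1 (lam H)) lam_conv //; exact: coalg_endo_id.
have idl : idm H · lam H = conv_one.
  by rewrite -{1}(compf1 (lam H)) conv_lam //; exact: coalg_endo_id.
by rewrite -(conv_1mul (_ ∘ _)) -idl -conv_mulA conv_lam // conv_mul1.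
Qed.

Lemma lam_inverse : is_inverse (lam H) (lam H).
Proof. by split; exact: lam_involutive. Qed.

(** * From an invertible action to a brace triple *)

Section FromAction.
Variables m b : Hom (H ⊗ H) H.
Hypothesis mG : is_tensor_coalgebra_morphism m.
Hypothesis mA : m ∘ (H ◁ m) = m ∘ (sub_mul m ▷ H) ∘ assoc'.
Hypothesis mD : distributes_over_mul m.
Hypothesis bG : is_tensor_coalgebra_morphism b.
Hypothesis mb : op_mul m b = op_one.
Hypothesis bm : op_mul b m = op_one.

(* The inverse of [x] for the group law [x ∘ y = x m(x, y)]. *)
Definition sub_inverse : Hom H H := conv b (idm H) (lam H).
Local Notation T := sub_inverse.

Lemma sub_inverse_coalg : coalg_endo T.
Proof.
by apply: coalg_endo_conv => //; [exact: coalg_endo_id | exact: coalg_endo_lam].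
Qed.

Lemma conv_mb f g : coalg_endo f -> conv m f (conv b f g) = g.
Proof. by move=> fG; rewrite conv_op_mul // mb conv_op_one. Qed.

(** Acting by [f] is multiplicative, so the image of the unit is an idempotent of a group. *)
Lemma conv_m_one f : coalg_endo f -> conv m f conv_one = conv_one.
Proof.
move=> fG; apply: conv_idempotent.
  by apply: coalg_endo_conv => //; exact: coalg_endo_one.
by rewrite -conv_distributes // conv_1mul.
Qed.

(** The unit acts by an idempotent operator, which has a left inverse because [m] has one. *)
Lemma op_at_m_one : op_at m conv_one = op_one.
Proof.
have oG := coalg_endo_one.
have idem : op_mul (op_at m conv_one) (op_at m conv_one) = op_at m conv_one.
  by rewrite conv_mul_op // conv_m_one // conv_1mul.
have inv : op_mul (op_at b conv_one) (op_at m conv_one) = op_one.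
  by rewrite -op_at_mul // bm op_at_one.
by rewrite -[LHS]op_1mul -inv -op_mulA idem.
Qed.

Lemma conv_one_m g : conv m conv_one g = g.
Proof. by rewrite conv_op_at op_at_m_one conv_op_one //; exact: coalg_endo_id. Qed.

Lemma conv_m_sub_inverse : conv m (idm H) T = lam H.
Proof. by rewrite conv_mb //; exact: coalg_endo_id. Qed.

(* A right inverse of the right inverse [T] of [id] is [id]. *)
Lemma conv_b_sub_inverse : conv b T (lam H ∘ T) = idm H.
Proof.
have TG := sub_inverse_coalg; have iG := coalg_endo_id.
set s := conv b T _.
have Ts : T · conv m T s = conv_one by rewrite conv_mb // conv_lam.
have idT : idm H · conv m (idm H) T = conv_one.
  by rewrite conv_m_sub_inverse -{1}(compf1 (lam H)) conv_lam.
symmetry.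
(* With f * g = f · m(f, g), the chain is id = id * (T * s) = (id * T) * s = s. *)
rewrite -(conv_mul1 (idm H)) -(conv_m_one iG) -Ts conv_distributes // conv_mulA idT.
by rewrite conv_act // idT conv_one_m conv_1mul.
Qed.

Lemma sub_inverse_involutive : T ∘ T = idm H.
Proof.
by rewrite {1}/sub_inverse (conv_comp _ _ _ sub_inverse_coalg) comp1f conv_b_sub_inverse.
Qed.

Lemma sub_inverse_conv_m : conv m T (idm H) = lam H ∘ T.
Proof. by rewrite -conv_b_sub_inverse conv_mb //; exact: sub_inverse_coalg. Qed.

(** Cocommutativity turns the conditions on coproducts into comultiplicativity of [T]. As [lam H]
    and [T] are involutive, both are isomorphisms, and [lam H] can stand for its inverse in the last
    condition. *)
Lemma sub_inverse_brace : is_brace_triple m T.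
Proof.
have [Te Td] := sub_inverse_coalg.
split=> //.
- by exists (lam H); exact: lam_inverse.
- by rewrite cocH.
- by apply: op_at_unit; exact: op_at_m_one.
- by exists T; split; exact: sub_inverse_involutive.
- by rewrite braid_nat -compA cocH.
- by rewrite Td.
- exact: conv_m_sub_inverse.
- move=> l lI; rewrite -(inverse_unique lam_inverse lI) -sub_inverse_conv_m.
  by rewrite /conv.
Qed.

End FromAction.

(** * From a brace triple to an inverse of its operation *)

Section FromBrace.
Variables (γ : Hom (H ⊗ H) H) (T : Hom H H).
Hypothesis bt : is_brace_triple γ T.

Lemma brace_T_coalg : coalg_endo T.
Proof.
split; first exact: brace_T_eps bt.
by rewrite (brace_T_delta bt) braid_nat -compA cocH.
Qed.

Lemma brace_at_one : op_at γ conv_one = op_one.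
Proof. by rewrite op_at_conv_one (brace_unit bt) comp1f. Qed.

Lemma brace_conv_id_T : conv γ (idm H) T = lam H.
Proof. by rewrite -(brace_T_r bt) /conv. Qed.

Lemma brace_conv_T_id : conv γ T (idm H) = lam H ∘ T.
Proof. exact: brace_T_l bt _ lam_inverse. Qed.

(** γ(x_1, γ(T(x_2), y)) = γ(x_1 γ(x_2, T(x_3)), y), where the first argument is x_1 λ(x_2) = ε(x)
    1. *)
Lemma brace_op_at_T_r : op_mul γ (op_at γ T) = op_one.
Proof.
have E := brace_assoc bt; have iG := coalg_endo_id.
rewrite -{1}(op_at_id γ) conv_mul_op // brace_conv_id_T.
by rewrite -{1}(compf1 (lam H)) conv_lam // brace_at_one.
Qed.

Lemma brace_op_at_T_l : op_mul (op_at γ T) γ = op_one.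
Proof.
have E := brace_assoc bt; have TG := brace_T_coalg.
rewrite -{2}(op_at_id γ) conv_mul_op // brace_conv_T_id.
by rewrite conv_lam // brace_at_one.
Qed.

(** A left inverse of [γ] solves the equation γ(x_1, T(x_2)) = λ(x) for [T]. *)
Lemma brace_T_unique ψ : op_mul ψ γ = op_one -> T = sub_inverse ψ.
Proof.
move=> E; have iG := coalg_endo_id.
by rewrite /sub_inverse -brace_conv_id_T conv_op_mul // E conv_op_one.
Qed.

End FromBrace.

End GroupLaws.
End Calculus.

(** * Operations precomposed with the braiding *)

Section BraidedInverse.
Context {C : strict_braided_category}.
Variable H : hopf_algebra C.
Hypothesis cocH : cocommutative H.
Implicit Types (R : C) (φ ψ : Hom (H ⊗ H) H).

Local Notation δ R := (lift12 (delta H) R).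
Local Notation c R := (lift22 (braid H H) R).

Lemma lift_comp_braid ψ R : lift21 (ψ ∘ braid H H) R = lift21 ψ R ∘ c R.
Proof. by rewrite !lift21E lift22E; strict. Qed.

(** The left side is φ(ψ(y, x_1), x_2), the form that convolution takes when the acted-on argument
    comes first; the right side has x_1 and x_2 exchanged. *)
Lemma op_mul_braid φ ψ :
  φ ∘ (ψ ▷ H) ∘ assoc' ∘ (H ◁ delta H) ∘ braid H H =
  op_mul (φ ∘ braid H H) (ψ ∘ braid H H).
Proof.
apply: lift21_inj => R; rewrite lift_op_mul !lift_comp_braid; nf.
transitivity (lift21 φ R ∘ (lift21 ψ (H ⊗ R) ∘ ((H ◁ δ R) ∘ c R))).
  by rewrite !lift21E lift12E lift22E; strict.
symmetry.
rw (braid_lift21_r _ _ _).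
rw (eq_sym (braid_lift12_l _ _ _)).
by rw1 (lift_cocommutative cocH _).
Qed.

Lemma counit_braid : runit ∘ (H ◁ eps H) ∘ braid H H = op_one H.
Proof. by rewrite -compA -braid_nat braid_unit_l /op_one; strict. Qed.

(** Carries (star) across the braiding. Crossing the copies of both arguments creates a double
    crossing, which is trivial because the braiding of [H] is involutive. *)
Lemma comul_braid ψ :
  delta H ∘ ψ = (ψ ⊠ ψ) ∘ tens_comul (delta H) (delta H) ->
  delta H ∘ (ψ ∘ braid H H) =
  ((ψ ∘ braid H H) ⊠ (ψ ∘ braid H H)) ∘ tens_comul (delta H) (delta H).
Proof.
move=> E; apply: comul_of_lift => R; rewrite !lift_comp_braid; nf.
rw (lift_comul_of E _).
rw (braid_lift12_l _ _ _).
rw (braid_lift12_r _ _ _).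
rw1 (lift_braid_involutive cocH _).
rw1 (braid_lift12_r _ _ _).
rw (eq_sym (lift22_nat _ _)).
rw (lift12_nat _ _).
by rw (eq_sym (lift21_nat _ _)).
Qed.

Lemma comp_braid_inj ψ ψ' : ψ ∘ braid H H = ψ' ∘ braid H H -> ψ = ψ'.
Proof.
by move=> E; rewrite -(compf1 ψ) -(compf1 ψ') -(braid_involutive cocH) !compA E.
Qed.

End BraidedInverse.

(** * Transposition along the dual *)

Section Dual.
Context {C : strict_braided_category}.
Variables (H : hopf_algebra C) (D : dual (hcar H)).
Implicit Types (R : C) (f g : Hom H (D ⊗ H)) (m : Hom (H ⊗ H) H).

Local Notation unit := (adj_unit (dual_adj D)).
Local Notation counit := (adj_counit (dual_adj D)).

(** Compatibility with tensoring on the right determines the counit from its component at the unit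
    object. *)
Lemma ev_counit R : lunit ∘ (ev D ▷ R) ∘ assoc' = counit R.
Proof.
transitivity (lunit ∘ ((counit unit_ob ▷ R) ∘ (((H ◁ runit') ▷ R) ∘ assoc'))).
  by rewrite /ev; strict.
rewrite -adj_counit_tens.
transitivity (lunit ∘ counit (unit_ob ⊗ R) ∘
  ((H ◁ assoc) ∘ assoc ∘ ((H ◁ runit') ▷ R) ∘ assoc')).
  by rewrite !compA.
by rewrite -adj_counit_nat; strict.
Qed.

Lemma counit_coev : counit H ∘ (H ◁ coev D) = runit.
Proof.
rewrite /coev whl_comp compA adj_counit_nat -compA adj_triangle_l compf1 //.
Qed.

Lemma beta_tildeE f : beta_tilde f = counit H ∘ (H ◁ f).
Proof. by rewrite /beta_tilde ev_counit. Qed.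

Lemma beta_tilde_inj f g : beta_tilde f = beta_tilde g -> f = g.
Proof.
have key h : (D ◁ beta_tilde h) ∘ unit H = h.
  by rewrite beta_tildeE whl_comp -compA -adj_unit_nat compA adj_triangle_r comp1f.
by move=> E; rewrite -(key f) -(key g) E.
Qed.

Lemma beta_tilde_surj m : beta_tilde ((D ◁ m) ∘ unit H) = m.
Proof.
by rewrite beta_tildeE whl_comp compA adj_counit_nat -compA adj_triangle_l compf1.
Qed.

(** [beta_tilde] is transposition along the adjunction. Naturality of the counit turns the
    evaluation inside [convolution] into composition, with [f] applied first. *)
Lemma beta_tilde_convolution f g :
  beta_tilde (convolution f g) =
  beta_tilde g ∘ (beta_tilde f ▷ H) ∘ assoc' ∘ (H ◁ delta H).
Proof.
rewrite !beta_tildeE /convolution ev_counit.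
transitivity (counit H ∘ (H ◁ (D ◁ counit H)) ∘
  (H ◁ (assoc ∘ (f ⊠ g) ∘ delta H))); first by rewrite !whl_comp !compA.
rewrite adj_counit_nat (tens_split_l f g).
transitivity (counit H ∘ ((H ◁ g) ∘ (counit H ▷ H)) ∘
  (((H ◁ f) ▷ H) ∘ assoc' ∘ (H ◁ delta H))); last by rewrite whr_comp !compA.
rewrite -(wh_swap (counit H) g) -adj_counit_tens; strict.
Qed.

Lemma beta_tilde_conv_unit :
  beta_tilde (lunit ∘ (eps H ⊠ coev D) ∘ runit') = runit ∘ (H ◁ eps H).
Proof.
rewrite beta_tildeE (tens_split_l (eps H) (coev D)).
transitivity (counit H ∘ (H ◁ coev D) ∘ (H ◁ eps H)); last by rewrite counit_coev.
strict.
Qed.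

Lemma beta_tilde_alpha m : beta_tilde (alpha m D) ∘ braid H H = m.
Proof.
rewrite beta_tildeE.
transitivity (counit H ∘ (H ◁ (D ◁ m)) ∘ ((H ◁ lift22 (braid H D) H) ∘
   ((H ◁ (H ◁ coev D)) ∘ lift22 (braid H H) unit_ob)) ∘ (H ◁ runit')).
  by rewrite /alpha !lift22E; strict.
rewrite adj_counit_nat lift22_nat -ev_counit.
have -> : lunit ∘ (ev D ▷ (H ⊗ H)) ∘ assoc' = lunit ∘ lift21 (ev D) (H ⊗ H).
  by rewrite lift21E compA.
transitivity (m ∘ ((lunit ∘ lift21 (ev D) (H ⊗ H)) ∘ ((H ◁ lift22 (braid H D) H) ∘
  lift22 (braid H H) (D ⊗ H))) ∘ (H ◁ (H ◁ coev D)) ∘ (H ◁ runit')).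
  by rewrite !compA.
(* The strand that crosses [D] in [alpha] slides past the evaluation; a triangle identity
   straightens the rest. *)
rewrite braid_lift20_r lift21E compA ev_counit.
transitivity (m ∘ (H ◁ (counit H ∘ (H ◁ coev D))) ∘ (H ◁ runit')).
  by rewrite !whl_comp !compA.
by rewrite counit_coev; strict.
Qed.

Hypothesis cocH : cocommutative H.

(** Transposition followed by the braiding is injective, sends [alpha m D] to [m], and carries
    convolution to [op_mul] with the factors reversed. *)
Lemma convolution_inverse_op m f :
  is_convolution_inverse (alpha m D) f <->
  op_mul m (beta_tilde f ∘ braid H H) = op_one H /\
  op_mul (beta_tilde f ∘ braid H H) m = op_one H.
Proof.
have key g h : convolution g h = lunit ∘ (eps H ⊠ coev D) ∘ runit' <->
    op_mul (beta_tilde h ∘ braid H H) (beta_tilde g ∘ braid H H) = op_one H.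
  rewrite -op_mul_braid // -beta_tilde_convolution -counit_braid -beta_tilde_conv_unit.
  by split=> [-> // | /(comp_braid_inj cocH) /beta_tilde_inj].
rewrite -{2 3}(beta_tilde_alpha m).
by split=> [[/key r /key l] | [/key l /key r]]; split.
Qed.

End Dual.

(** * Post-Hopf structures and brace triples on a fixed Hopf algebra *)

Section Correspondence.
Context {C : strict_braided_category}.
Variable H : hopf_algebra C.
Hypothesis cocH : cocommutative H.
Implicit Type m : Hom (H ⊗ H) H.

Lemma post_hopf_brace m :
  is_post_hopf m -> star m -> exists T, is_brace_triple m T.
Proof.
move=> [[D] mG mA mD mconv] mstar.
have [β βI] := mconv D.
have /(convolution_inverse_op cocH) [mb bm] := βI.
exists (sub_inverse (beta_tilde β ∘ braid H H)).
apply: sub_inverse_brace => //.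
apply: (op_inverse_tensor_coalg mG) => //.
by apply: comul_braid => //; rewrite (mstar _ _ βI) /tens_comul compA.
Qed.

Lemma brace_post_hopf m T :
  finite (hcar H) -> is_brace_triple m T -> is_post_hopf m /\ star m.
Proof.
move=> Hfin bt.
have mr := brace_op_at_T_r bt; have ml := brace_op_at_T_l cocH bt.
split.
  split=> //; [exact: brace_coalg bt | exact: brace_assoc bt | exact: brace_distr bt |].
  (* The witness is the transpose of m(T(x), y) with its arguments crossed. *)
  move=> D; exists ((D ◁ (op_at m T ∘ braid H H)) ∘ adj_unit (dual_adj D) H).
  by apply/(convolution_inverse_op cocH); rewrite beta_tilde_surj -compA braid_involutive // compf1.
move=> D β /(convolution_inverse_op cocH) [_ bm].
(* Inverses in the monoid of operations are unique, so every [β] yields m(T(x), y). *)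
have E : op_at m T = beta_tilde β ∘ braid H H.
  by symmetry; apply: op_mul_inverse_unique bm mr.
have -> : beta_tilde β = op_at m T ∘ braid H H.
  by rewrite E -compA braid_involutive // compf1.
rewrite (comul_braid cocH (op_at_comul (brace_coalg bt) (brace_T_coalg cocH bt))).
by rewrite /tens_comul compA.
Qed.

Lemma brace_T_determined m T T' :
  is_brace_triple m T -> is_brace_triple m T' -> T = T'.
Proof.
move=> bt bt'; have ml := brace_op_at_T_l cocH bt.
by rewrite (brace_T_unique bt ml) (brace_T_unique bt' ml).
Qed.

End Correspondence.

(** * The two functors and their composites *)

Section Functors.
Variable C : strict_braided_category.

(** [post_conv] gives [β] only as a propositional existence, so [T] is obtained by choice;
    [brace_T_determined] makes the result independent of it. *)
Definition post_T (X : cocPost_Hopf_star C) :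
    {T | is_brace_triple (post_op (proj1_sig X)) T} :=
  constructive_indefinite_description _
    (post_hopf_brace (proj1 (proj2_sig X)) (post_hopfP (proj1_sig X)) (proj2 (proj2_sig X))).

Definition to_brace_ob (X : cocPost_Hopf_star C) : cocBT_f C :=
  exist _ (BraceTriple (proj2_sig (post_T X)))
    (conj (post_finite (post_hopfP (proj1_sig X))) (proj1 (proj2_sig X))).

Definition to_brace : functor (cocPost_Hopf_star C) (cocBT_f C) :=
  {| fob := to_brace_ob; fmap := fun X Y f => f;
     fmap_id := fun X => eq_refl; fmap_comp := fun X Y Z g f => eq_refl |}.

Definition to_post_ob (X : cocBT_f C) : cocPost_Hopf_star C :=
  let P := brace_post_hopf (proj2 (proj2_sig X)) (proj1 (proj2_sig X))
             (brace_tripleP (proj1_sig X)) in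
  exist _ (PostHopf (proj1 P)) (conj (proj2 (proj2_sig X)) (proj2 P)).

Definition to_post : functor (cocBT_f C) (cocPost_Hopf_star C) :=
  {| fob := to_post_ob; fmap := fun X Y f => f;
     fmap_id := fun X => eq_refl; fmap_comp := fun X Y Z g f => eq_refl |}.

(** Morphisms see only [H] and [m], so Hom X X' and Hom X X are convertible and the cast can be
    compared with [idm X], as [functor_eq] requires. *)
Lemma post_ob_idto (H : hopf_algebra C) (m : Hom (H ⊗ H) H) (p p' : is_post_hopf m)
    q q' (X := exist _ (PostHopf p) q : cocPost_Hopf_star C)
    (X' := exist _ (PostHopf p') q' : cocPost_Hopf_star C) :
  exists e : X = X', idto e = idm X.
Proof.
rewrite /X /X' {X X'}; move: q'; rewrite (proof_irrelevance _ p' p) => q'.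
by rewrite (proof_irrelevance _ q' q); exists eq_refl.
Qed.

Lemma brace_ob_idto (H : hopf_algebra C) (m : Hom (H ⊗ H) H) (T T' : Hom H H)
    (p : is_brace_triple m T) (p' : is_brace_triple m T') q q'
    (X := exist _ (BraceTriple p) q : cocBT_f C)
    (X' := exist _ (BraceTriple p') q' : cocBT_f C) :
  exists e : X = X', idto e = idm X.
Proof.
rewrite /X /X' {X X'}; have ET := brace_T_determined (proj2 q) p p'.
move: p' q'; rewrite -ET => p'.
rewrite (proof_irrelevance _ p' p) => q'.
by rewrite (proof_irrelevance _ q' q); exists eq_refl.
Qed.

Lemma to_post_to_brace X : exists e : to_post (to_brace X) = X, idto e = idm X.
Proof. case: X => [[H m p] q]; exact: post_ob_idto. Qed.

Lemma to_brace_to_post X : exists e : to_brace (to_post X) = X, idto e = idm X.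
Proof. case: X => [[H m T p] q]; exact: brace_ob_idto. Qed.

End Functors.

Theorem theorem3p16 (C : strict_braided_category) :
  isomorphic_categories (cocPost_Hopf_star C) (cocBT_f C).
Proof.
exists (to_brace C), (to_post C); split.
- have e X : to_post C (to_brace C X) = X by case: (to_post_to_brace X).
  exists e => X Y f.
  have [eX EX] := to_post_to_brace X; have [eY EY] := to_post_to_brace Y.
  (* Proof irrelevance replaces [e] by the equalities whose casts are known to be identities. *)
  rewrite (idto_irrel (e X) eX) (idto_irrel (e Y) eY) EX EY.
  exact: (eq_trans (comp1f f) (eq_sym (compf1 f))).
- have e X : to_brace C (to_post C X) = X by case: (to_brace_to_post X).
  exists e => X Y f.
  have [eX EX] := to_brace_to_post X; have [eY EY] := to_brace_to_post Y.
  rewrite (idto_irrel (e X) eX) (idto_irrel (e Y) eY) EX EY.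
  exact: (eq_trans (comp1f f) (eq_sym (compf1 f))).
Qed.
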